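(* Let $T_*>\tau_D$ and $\mu_0\in(0,1)$ be constants. There exist a continuous function $\xi_{\mu_0}:[0,T_*]\to(0,1]$ and a constant $\gamma_2>0$, depending only on $\mu_0,n,a_*,a^*,\tau_D,T_*$, with $\xi_{\mu_0}(0)=1$, $\xi_{\mu_0}$ strictly decreasing on $[0,\tau_D]$, strictly increasing on $[\tau_D,T_*]$ and $\xi_{\mu_0}(T_* )<1$, such that the following holds. For any trajectory of system (5) with $\|z\|_\infty<\infty$, any $t_0\ge 0$, any constant $d_0>0$, and any $i,m\in\mathcal V_F$ such that the arc $(i,m)$ belongs to $\mathcal E_{\sigma(t)}$ for all $t\in[t_0,t_0+\tau_D)$ and $$|x_i(t)|_{\mathcal L(y(t))}\le\mu_0|x(t_0)|_{\mathcal L(y(t_0))}+d_0\quad\text{for all }t\in[t_0,t_0+\tau_D),$$ we have $$|x_m(t)|_{\mathcal L(y(t))}\le\xi_{\mu_0}(t-t_0)\,|x(t_0)|_{\mathcal L(y(t_0))}+\gamma_2\|z\|_\infty+d_0\quad\text{for all }t\in[t_0,t_0+T_*].$$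
   Context: Standing setup. Fix integers $n\ge 2$, $k\ge 1$, $d\ge 1$. The follower set is $\mathcal V_F=\{1,\dots,n\}$ and the leader set is $\mathcal V_L=\{\hat 1,\dots,\hat k\}$ (disjoint from $\mathcal V_F$); $\mathcal V=\mathcal V_F\cup\mathcal V_L$. The interaction topology is a time-varying digraph $\mathcal G_{\sigma(t)}=(\mathcal V,\mathcal E_{\sigma(t)})$, where $\sigma:[0,\infty)\to\mathcal P$ is a piecewise constant switching signal taking values in a finite set $\mathcal P$ of digraphs on $\mathcal V$; no arc of any of these digraphs enters a leader. An arc $(j,i)$ means that $i$ receives information from $j$. Dwell-time assumption: any two consecutive switching instants of $\sigma$ are separated by at least $\tau_D>0$. For $i\in\mathcal V_F$, $N_i(\sigma(t))=\{j\in\mathcal V_F:(j,i)\in\mathcal E_{\sigma(t)}\}$ and $L_i(\sigma(t))=\{j\in\mathcal V_L:(j,i)\in\mathcal E_{\sigma(t)}\}$. System (5): $\dot y_i=u_i(y,t)$ for $i=1,\dots,k$, and $\dot x_i=\sum_{j\in N_i(\sigma(t))}a_{ij}(x,y,t)(x_j-x_i)+\sum_{j\in L_i(\sigma(t))}b_{ij}(x,y,t)(y_j-x_i)+w_i(t)$ for $i=1,\dots,n$, where $x_i,y_j\in\mathbb R^d$, $x=(x_1,\dots,x_n)$, $y=(y_1,\dots,y_k)$; each $u_i(y,t)$ is continuous in $y$ and piecewise continuous in $t$; each $w_i$ is continuous; the weights $a_{ij},b_{ij}$ are continuous and satisfy $a_*\le a_{ij}(x,y,t)\le a^*$, $b_{ij}(x,y,t)\ge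 b_*$ for all $x,y,t$, with constants $0<a_*\le a^*$, $b_*>0$. Along a trajectory, $z(t)=(u_1(y(t),t),\dots,u_k(y(t),t),w_1(t),\dots,w_n(t))\in\mathbb R^{(n+k)d}$ and $\|z\|_\infty=\sup_{t\ge0}|z(t)|$. Set notation: $|\cdot|$ is the Euclidean norm; for a closed convex $K\subset\mathbb R^d$, $|v|_K=\inf_{p\in K}|v-p|$; $\mathcal L(y(t))=\mathrm{co}\{y_1(t),\dots,y_k(t)\}$ (convex hull); $|x(t)|_{\mathcal L(y(t))}=\max_{i\in\mathcal V_F}|x_i(t)|_{\mathcal L(y(t))}$. *)

(* Defs.v *)
From Stdlib Require Import Reals Lra List ClassicalEpsilon.
Import ListNotations.
Open Scope R_scope.

Definition rsum (m : nat) (f : nat -> R) : R :=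
  fold_right Rplus 0 (map f (seq 0 m)).

(** Infimum of a set of reals (chosen by the whitelisted epsilon operator;
    it is the genuine infimum whenever one exists). *)
Definition is_inf (E : R -> Prop) (m : R) : Prop :=
  (forall r, E r -> m <= r) /\ (forall b, (forall r, E r -> b <= r) -> b <= m).
Definition Inf (E : R -> Prop) : R := epsilon (inhabits 0) (is_inf E).

(** Vectors of R^d are represented as [nat -> R] (components 0..d-1). *)
Definition vnorm (d : nat) (v : nat -> R) : R := sqrt (rsum d (fun c => v c ^ 2)).

Definition in_hull (d k : nat) (Y : nat -> nat -> R) (p : nat -> R) : Prop :=
  exists lam : nat -> R,
    (forall j, (j < k)%nat -> 0 <= lam j) /\ rsum k lam = 1 /\
    (forall c, (c < d)%nat -> p c = rsum k (fun j => lam j * Y j c)).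

Definition hull_dist (d k : nat) (v : nat -> R) (Y : nat -> nat -> R) : R :=
  Inf (fun r => exists p, in_hull d k Y p /\ r = vnorm d (fun c => v c - p c)).

Definition max_hull_dist (n d k : nat) (X Y : nat -> nat -> R) : R :=
  fold_right Rmax 0 (map (fun i => hull_dist d k (X i) Y) (seq 0 n)).

Inductive vtx : Type := Fol (i : nat) | Lead (j : nat).

(** A digraph on the vertices: [g u v = true] means arc (u,v), i.e. v receives
    information from u. *)
Definition digraph := vtx -> vtx -> bool.

(** The switching instants are contained in {s m}. *)
Definition dwell_signal (tauD : R) (sg : R -> digraph) : Prop :=
  (forall t u j, sg t u (Lead j) = false) /\
  exists s : nat -> R, s 0%nat <= 0 /\
    (forall m, s (S m) - s m >= tauD) /\
    (forall m t t', s m <= t < s (S m) -> s m <= t' < s (S m) -> sg t = sg t').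

Definition loc_finite (D : R -> Prop) : Prop :=
  forall T, exists l : list R, forall t, D t -> 0 <= t <= T -> In t l.

Definition cont_at_nonneg (f : R -> R) (t : R) : Prop :=
  forall eps, eps > 0 -> exists del, del > 0 /\
    forall t', 0 <= t' -> Rabs (t' - t) < del -> Rabs (f t' - f t) < eps.
Definition cont_nonneg (f : R -> R) : Prop :=
  forall t, 0 <= t -> cont_at_nonneg f t.

Definition pw_cont_nonneg (f : R -> R) : Prop :=
  exists D, loc_finite D /\
    (forall t, 0 <= t -> ~ D t -> cont_at_nonneg f t) /\
    (forall t, D t -> 0 <= t ->
       (exists l, forall eps, eps > 0 -> exists del, del > 0 /\
          forall t', t < t' < t + del -> Rabs (f t' - l) < eps) /\
       (0 < t -> exists l, forall eps, eps > 0 -> exists del, del > 0 /\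
          forall t', 0 <= t' -> t - del < t' < t -> Rabs (f t' - l) < eps)).

Definition cont_xyt (n k d : nat)
  (f : (nat -> nat -> R) -> (nat -> nat -> R) -> R -> R) : Prop :=
  forall X Y t, 0 <= t -> forall eps, eps > 0 -> exists del, del > 0 /\
    forall X' Y' t', 0 <= t' -> Rabs (t' - t) < del ->
      (forall i c, (i < n)%nat -> (c < d)%nat -> Rabs (X' i c - X i c) < del) ->
      (forall j c, (j < k)%nat -> (c < d)%nat -> Rabs (Y' j c - Y j c) < del) ->
      Rabs (f X' Y' t' - f X Y t) < eps.

Definition cont_y (k d : nat) (f : (nat -> nat -> R) -> R) : Prop :=
  forall Y eps, eps > 0 -> exists del, del > 0 /\
    forall Y', (forall j c, (j < k)%nat -> (c < d)%nat -> Rabs (Y' j c - Y j c) < del) ->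
      Rabs (f Y' - f Y) < eps.

Definition system_data (n k d : nat) (a_lo a_hi b_lo : R)
  (a : nat -> nat -> (nat -> nat -> R) -> (nat -> nat -> R) -> R -> R)
  (b : nat -> nat -> (nat -> nat -> R) -> (nat -> nat -> R) -> R -> R)
  (u : nat -> (nat -> nat -> R) -> R -> nat -> R)
  (w : nat -> R -> nat -> R) : Prop :=
  (forall i j, (i < n)%nat -> (j < n)%nat ->
     cont_xyt n k d (a i j) /\
     forall X Y t, 0 <= t -> a_lo <= a i j X Y t <= a_hi) /\
  (forall i j, (i < n)%nat -> (j < k)%nat ->
     cont_xyt n k d (b i j) /\
     forall X Y t, 0 <= t -> b_lo <= b i j X Y t) /\
  (forall j c, (j < k)%nat -> (c < d)%nat ->
     (forall t, 0 <= t -> cont_y k d (fun Y => u j Y t c)) /\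
     (forall Y, pw_cont_nonneg (fun t => u j Y t c))) /\
  (forall i c, (i < n)%nat -> (c < d)%nat -> cont_nonneg (fun t => w i t c)).

Definition follower_rhs (n k : nat) (sg : R -> digraph)
  (a b : nat -> nat -> (nat -> nat -> R) -> (nat -> nat -> R) -> R -> R)
  (w : nat -> R -> nat -> R)
  (x y : R -> nat -> nat -> R) (i c : nat) (t : R) : R :=
  rsum n (fun j => if sg t (Fol j) (Fol i)
                   then a i j (x t) (y t) t * (x t j c - x t i c) else 0)
  + rsum k (fun j => if sg t (Lead j) (Fol i)
                     then b i j (x t) (y t) t * (y t j c - x t i c) else 0)
  + w i t c.

(** (x,y) is a trajectory of (5) on [0,oo): continuous, and satisfying the
    differential equations at every t > 0 outside a locally finite set
    (switching instants, discontinuities of u in t). *)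
Definition trajectory (n k d : nat) (sg : R -> digraph)
  (a b : nat -> nat -> (nat -> nat -> R) -> (nat -> nat -> R) -> R -> R)
  (u : nat -> (nat -> nat -> R) -> R -> nat -> R)
  (w : nat -> R -> nat -> R)
  (x y : R -> nat -> nat -> R) : Prop :=
  (forall i c, (i < n)%nat -> (c < d)%nat -> cont_nonneg (fun t => x t i c)) /\
  (forall j c, (j < k)%nat -> (c < d)%nat -> cont_nonneg (fun t => y t j c)) /\
  exists D, loc_finite D /\
    forall t, 0 < t -> ~ D t ->
      (forall j c, (j < k)%nat -> (c < d)%nat ->
         derivable_pt_lim (fun s => y s j c) t (u j (y t) t c)) /\
      (forall i c, (i < n)%nat -> (c < d)%nat ->
         derivable_pt_lim (fun s => x s i c) t (follower_rhs n k sg a b w x y i c t)).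

Definition z_norm (n k d : nat) (u : nat -> (nat -> nat -> R) -> R -> nat -> R)
  (w : nat -> R -> nat -> R) (y : R -> nat -> nat -> R) (t : R) : R :=
  sqrt (rsum k (fun j => rsum d (fun c => u j (y t) t c ^ 2))
        + rsum n (fun i => rsum d (fun c => w i t c ^ 2))).

Definition cont_on (lo hi : R) (f : R -> R) : Prop :=
  forall t, lo <= t <= hi -> forall eps, eps > 0 -> exists del, del > 0 /\
    forall t', lo <= t' <= hi -> Rabs (t' - t) < del -> Rabs (f t' - f t) < eps.

(* Main.v *)
(** Write V_l(t) = |x_l(t)|_{L(y(t))} for the distance of follower l to the
    convex hull of the leaders, M = |x(t0)|_{L(y(t0))}, Z = ||z||_oo and
    K = n a^*.  The proof is a comparison argument for the upper right Dini
    derivative of V_l, developed in the following order.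
    - Finite sums, the Euclidean norm, and the distance to a convex hull:
      it is 1-Lipschitz in the point, moves by at most B when every vertex
      moves by at most B, vanishes at vertices and is convex.  Convexity
      applied to an explicit Euler step of (5) is the geometric core.
    - A maximum principle: continuous functions whose maximum never increases
      immediately to the right, except on a finite set, stay below their
      initial maximum; rates are compared through one-sided Dini bounds.
    - The comparison function xi: slope -c on [0, tauD], then the relaxation
      1 - c tauD e^{-K (s - tauD)} solving xi' = K (1 - xi).
    - Along a trajectory, D^+ V_l <= sum_{q in N_l} a_lq (V_q - V_l) + 2 Z
      outside a finite set of times.  The maximum principle gives the growth
      bound V_q(t) <= M + 2 Z (t - t0), and then, applied to V_m minus the
      comparison bound xi(t - t0) M + d0 + 2 Z (t - t0), the estimate of
      Lemma 6 with gamma2 = 2 Tstar: on [t0, t0 + tauD] the arc (i,m) pulls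
      V_m towards the smaller V_i, afterwards V_m grows at rate at most
      K (1 - xi) M. *)

Require Import Defs.
From Stdlib Require Import Reals Lra Lia List ClassicalEpsilon Classical.
Open Scope R_scope.

(** ** Finite sums *)

Lemma rsum_S N f : rsum (S N) f = rsum N f + f N.
Proof.
  assert (Hacc : forall a l, fold_right Rplus a l = a + fold_right Rplus 0 l).
  { intros a l; induction l as [|z l IH]; simpl; [lra | rewrite IH; lra]. }
  unfold rsum. rewrite seq_S, map_app, fold_right_app. simpl. rewrite Hacc. lra.
Qed.

Lemma rsum_ext N f g : (forall q, (q < N)%nat -> f q = g q) -> rsum N f = rsum N g.
Proof.
  induction N; intros H; [reflexivity|]. rewrite !rsum_S, IHN, H; [reflexivity|lia|].
  intros; apply H; lia.
Qed.

Lemma rsum_plus N f g : rsum N (fun q => f q + g q) = rsum N f + rsum N g.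
Proof. induction N; [unfold rsum; simpl; lra|]. rewrite !rsum_S, IHN; lra. Qed.

Lemma rsum_scal N c f : rsum N (fun q => c * f q) = c * rsum N f.
Proof. induction N; [unfold rsum; simpl; lra|]. rewrite !rsum_S, IHN; lra. Qed.

Lemma rsum_scal_r N f c : rsum N (fun q => f q * c) = rsum N f * c.
Proof. rewrite Rmult_comm, <- rsum_scal. apply rsum_ext; intros; ring. Qed.

Lemma rsum_const N c : rsum N (fun _ => c) = INR N * c.
Proof. induction N; [unfold rsum; simpl; lra|]. rewrite rsum_S, IHN, S_INR; lra. Qed.

Lemma rsum_le N f g : (forall q, (q < N)%nat -> f q <= g q) -> rsum N f <= rsum N g.
Proof.
  induction N; intros H; [unfold rsum; simpl; lra|]. rewrite !rsum_S.
  assert (f N <= g N) by (apply H; lia).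
  assert (rsum N f <= rsum N g) by (apply IHN; intros; apply H; lia). lra.
Qed.

Lemma rsum_nonneg N f : (forall q, (q < N)%nat -> 0 <= f q) -> 0 <= rsum N f.
Proof.
  intros H. replace 0 with (rsum N (fun _ => 0)) by (rewrite rsum_const; ring).
  apply rsum_le; auto.
Qed.

Lemma rsum_term_le N f j :
  (forall q, (q < N)%nat -> 0 <= f q) -> (j < N)%nat -> f j <= rsum N f.
Proof.
  induction N; intros H Hj; [lia|]. rewrite rsum_S.
  destruct (Nat.eq_dec j N) as [->|Hne].
  - assert (0 <= rsum N f) by (apply rsum_nonneg; intros; apply H; lia). lra.
  - assert (f j <= rsum N f) by (apply IHN; [intros; apply H; lia|lia]).
    assert (0 <= f N) by (apply H; lia). lra.
Qed.

Lemma rsum_one_plus N g i beta : (i < N)%nat -> 0 <= beta ->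
  (forall q, (q < N)%nat -> g q <= beta) -> rsum N g <= g i + INR N * beta.
Proof.
  induction N; intros Hi Hb H; [lia|]. rewrite rsum_S, S_INR.
  destruct (Nat.eq_dec i N) as [->|Hne].
  - assert (rsum N g <= rsum N (fun _ => beta)) by (apply rsum_le; intros; apply H; lia).
    rewrite rsum_const in H0. lra.
  - assert (rsum N g <= g i + INR N * beta) by (apply IHN; [lia|auto|intros; apply H; lia]).
    assert (g N <= beta) by (apply H; lia). lra.
Qed.

Lemma rsum_exchange N M (F : nat -> nat -> R) :
  rsum N (fun q => rsum M (fun j => F q j)) = rsum M (fun j => rsum N (fun q => F q j)).
Proof.
  induction N.
  - unfold rsum at 1; simpl.
    rewrite (rsum_ext M _ (fun _ => 0)) by reflexivity. rewrite rsum_const. ring.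
  - rewrite rsum_S, IHN, <- rsum_plus. apply rsum_ext. intros. rewrite rsum_S. reflexivity.
Qed.

Lemma rsum_delta N j (g : nat -> R) : (j < N)%nat ->
  rsum N (fun q => if Nat.eqb q j then g q else 0) = g j.
Proof.
  induction N; intros Hj; [lia|]. rewrite rsum_S.
  destruct (Nat.eq_dec j N) as [->|Hne].
  - rewrite Nat.eqb_refl, (rsum_ext N _ (fun _ => 0)), rsum_const; [lra|].
    intros q Hq. destruct (Nat.eqb_spec q N); [lia|reflexivity].
  - rewrite IHN by lia. destruct (Nat.eqb_spec N j); [lia|lra].
Qed.

Lemma rsum_blocks n k f :
  rsum (S (n + k)) f = rsum n f + rsum k (fun j => f (n + j)%nat) + f (n + k)%nat.
Proof.
  rewrite rsum_S. f_equal. induction k.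
  - rewrite Nat.add_0_r. change (rsum 0 (fun j => f (n + j)%nat)) with 0. lra.
  - rewrite Nat.add_succ_r, !rsum_S, IHk. lra.
Qed.

(** ** The Euclidean norm on R^d *)

Lemma le_of_sq a b : 0 <= b -> a * a <= b * b -> a <= b.
Proof. intros. nra. Qed.

Lemma cauchy_schwarz d (v v' : nat -> R) :
  rsum d (fun c => v c * v' c) * rsum d (fun c => v c * v' c)
  <= rsum d (fun c => v c * v c) * rsum d (fun c => v' c * v' c).
Proof.
  induction d; [unfold rsum; simpl; lra|]. rewrite !rsum_S.
  set (s := rsum d (fun c => v c * v' c)) in *.
  set (p := rsum d (fun c => v c * v c)) in *.
  set (q := rsum d (fun c => v' c * v' c)) in *.
  assert (Hp : 0 <= p) by (apply rsum_nonneg; intros; nra).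
  assert (Hq : 0 <= q) by (apply rsum_nonneg; intros; nra).
  set (X := v d) in *. set (Y := v' d) in *.
  (* 2 s X Y <= p Y^2 + q X^2, by AM-GM and s^2 <= p q *)
  assert (Hcross : 2 * s * X * Y <= p * (Y * Y) + q * (X * X)).
  { set (T := p * (Y * Y) + q * (X * X)).
    assert (HT : 0 <= T) by (unfold T; nra).
    assert (T * T - 4 * p * q * (X * X) * (Y * Y)
            = (p * (Y * Y) - q * (X * X)) * (p * (Y * Y) - q * (X * X))) by (unfold T; ring).
    assert (4 * (s * s) * (X * X) * (Y * Y) <= 4 * (p * q) * (X * X) * (Y * Y)).
    { apply Rmult_le_compat_r; [nra|]. apply Rmult_le_compat_r; [nra|]. lra. }
    assert (Hsq : (2 * s * X * Y) * (2 * s * X * Y) <= T * T).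
    { assert (0 <= (p * (Y * Y) - q * (X * X)) * (p * (Y * Y) - q * (X * X)))
        by apply Rle_0_sqr.
      replace ((2 * s * X * Y) * (2 * s * X * Y))
        with (4 * (s * s) * (X * X) * (Y * Y)) by ring. lra. }
    nra. }
  assert (Hexp : (s + X * Y) * (s + X * Y) = s * s + 2 * s * X * Y + (X * X) * (Y * Y)) by ring.
  assert (Hexp' : (p + X * X) * (q + Y * Y)
                  = p * q + (p * (Y * Y) + q * (X * X)) + (X * X) * (Y * Y)) by ring.
  rewrite Hexp, Hexp'. lra.
Qed.

Lemma vnorm_ext d v v' : (forall c, (c < d)%nat -> v c = v' c) -> vnorm d v = vnorm d v'.
Proof. intros H. unfold vnorm. f_equal. apply rsum_ext. intros; rewrite H; auto. Qed.

Lemma vnorm_nonneg d v : 0 <= vnorm d v.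
Proof. apply sqrt_pos. Qed.

Lemma vnorm_sq d v : vnorm d v * vnorm d v = rsum d (fun c => v c * v c).
Proof.
  unfold vnorm. rewrite sqrt_sqrt.
  - apply rsum_ext; intros; ring.
  - apply rsum_nonneg; intros; nra.
Qed.

Lemma vnorm_zero d v : (forall c, (c < d)%nat -> v c = 0) -> vnorm d v = 0.
Proof.
  intros H. unfold vnorm. rewrite (rsum_ext _ _ (fun _ => 0)).
  - rewrite rsum_const, Rmult_0_r. apply sqrt_0.
  - intros; rewrite H; auto; ring.
Qed.

Lemma vnorm_scal d al v : vnorm d (fun c => al * v c) = Rabs al * vnorm d v.
Proof.
  assert (Hsq : vnorm d (fun c => al * v c) * vnorm d (fun c => al * v c)
                = (Rabs al * vnorm d v) * (Rabs al * vnorm d v)).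
  { replace (Rabs al * vnorm d v * (Rabs al * vnorm d v))
      with ((Rabs al * Rabs al) * (vnorm d v * vnorm d v)) by ring.
    rewrite !vnorm_sq, <- Rabs_mult, Rabs_right by nra. rewrite <- rsum_scal.
    apply rsum_ext; intros; ring. }
  pose proof (vnorm_nonneg d (fun c => al * v c)).
  pose proof (Rabs_pos al). pose proof (vnorm_nonneg d v).
  apply Rle_antisym; apply le_of_sq; nra.
Qed.

Lemma vnorm_triang d v v' : vnorm d (fun c => v c + v' c) <= vnorm d v + vnorm d v'.
Proof.
  pose proof (vnorm_nonneg d v). pose proof (vnorm_nonneg d v').
  assert (Hcs : rsum d (fun c => v c * v' c) <= vnorm d v * vnorm d v').
  { apply le_of_sq; [nra|].
    replace (vnorm d v * vnorm d v' * (vnorm d v * vnorm d v'))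
      with ((vnorm d v * vnorm d v) * (vnorm d v' * vnorm d v')) by ring.
    rewrite !vnorm_sq. apply cauchy_schwarz. }
  apply le_of_sq; [lra|]. rewrite vnorm_sq.
  replace (rsum d (fun c => (v c + v' c) * (v c + v' c))) with
    (rsum d (fun c => v c * v c) + 2 * rsum d (fun c => v c * v' c)
     + rsum d (fun c => v' c * v' c)).
  - rewrite <- !vnorm_sq. nra.
  - rewrite <- rsum_scal, <- !rsum_plus. apply rsum_ext; intros; ring.
Qed.

Lemma vnorm_sym d v v' : vnorm d (fun c => v c - v' c) = vnorm d (fun c => v' c - v c).
Proof.
  rewrite (vnorm_ext d (fun c => v c - v' c) (fun c => (-1) * (v' c - v c))) by (intros; ring).
  rewrite vnorm_scal, Rabs_left by lra. ring.
Qed.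

Lemma vnorm_le_abs d v : vnorm d v <= rsum d (fun c => Rabs (v c)).
Proof.
  induction d.
  - unfold vnorm, rsum; simpl. rewrite sqrt_0. lra.
  - assert (H0 : 0 <= rsum d (fun c => Rabs (v c))) by (apply rsum_nonneg; intros; apply Rabs_pos).
    pose proof (vnorm_nonneg d v). pose proof (Rabs_pos (v d)).
    assert (Habs : Rabs (v d) * Rabs (v d) = v d * v d)
      by (rewrite <- Rabs_mult; apply Rabs_right; nra).
    apply le_of_sq; [rewrite rsum_S; lra|].
    rewrite vnorm_sq, !rsum_S, <- vnorm_sq. nra.
Qed.

Lemma vnorm_small d v e : 0 <= e -> (forall c, (c < d)%nat -> Rabs (v c) < e) ->
  vnorm d v <= INR d * e.
Proof.
  intros He H. eapply Rle_trans; [apply vnorm_le_abs|]. rewrite <- rsum_const.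
  apply rsum_le. intros; left; auto.
Qed.

Lemma vnorm_sum d N (al : nat -> R) (V : nat -> nat -> R) :
  vnorm d (fun c => rsum N (fun q => al q * V q c))
  <= rsum N (fun q => Rabs (al q) * vnorm d (V q)).
Proof.
  induction N.
  - unfold rsum; simpl. rewrite vnorm_zero; [lra|]. reflexivity.
  - rewrite rsum_S. eapply Rle_trans.
    + rewrite (vnorm_ext d _ (fun c => rsum N (fun q => al q * V q c) + al N * V N c))
        by (intros; apply rsum_S).
      apply vnorm_triang.
    + rewrite vnorm_scal. lra.
Qed.
(** ** Distance to the convex hull of the leaders *)

Lemma hull_vertex d k Y j : (j < k)%nat -> in_hull d k Y (Y j).
Proof.
  intros Hj. exists (fun q => if Nat.eqb q j then 1 else 0). split; [|split].
  - intros q _. destruct (Nat.eqb q j); lra.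
  - apply (rsum_delta k j (fun _ => 1)); auto.
  - intros c _. symmetry.
    rewrite (rsum_ext _ _ (fun q => if Nat.eqb q j then Y q c else 0)).
    + apply (rsum_delta k j (fun q => Y q c)); auto.
    + intros q _. destruct (Nat.eqb q j); ring.
Qed.

Lemma hull_comb d k Y N (al : nat -> R) (P : nat -> nat -> R) :
  (forall q, (q < N)%nat -> 0 <= al q) -> rsum N al = 1 ->
  (forall q, (q < N)%nat -> in_hull d k Y (P q)) ->
  in_hull d k Y (fun c => rsum N (fun q => al q * P q c)).
Proof.
  intros Hal Hs HP.
  assert (Hc : forall q, exists lam, (q < N)%nat ->
    (forall j, (j < k)%nat -> 0 <= lam j) /\ rsum k lam = 1 /\
    (forall c, (c < d)%nat -> P q c = rsum k (fun j => lam j * Y j c))).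
  { intros q. destruct (Compare_dec.le_lt_dec N q).
    - exists (fun _ => 0). intros; lia.
    - destruct (HP q l) as [lam H]. exists lam; auto. }
  destruct (choice _ Hc) as [f Hf].
  exists (fun j => rsum N (fun q => al q * f q j)). split; [|split].
  - intros j Hj. apply rsum_nonneg. intros q Hq. destruct (Hf q Hq) as [H1 _].
    apply Rmult_le_pos; auto.
  - rewrite <- rsum_exchange, <- Hs. apply rsum_ext. intros q Hq.
    rewrite rsum_scal. destruct (Hf q Hq) as [_ [H2 _]]. rewrite H2; ring.
  - intros c Hc'.
    rewrite (rsum_ext k _ (fun j => rsum N (fun q => al q * f q j * Y j c)))
      by (intros; rewrite <- rsum_scal_r; reflexivity).
    rewrite <- rsum_exchange. apply rsum_ext. intros q Hq.
    destruct (Hf q Hq) as [_ [_ H3]]. rewrite H3 by auto. rewrite <- rsum_scal.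
    apply rsum_ext; intros; ring.
Qed.

Definition hull_gaps (d k : nat) (v : nat -> R) (Y : nat -> nat -> R) : R -> Prop :=
  fun r => exists p, in_hull d k Y p /\ r = vnorm d (fun c => v c - p c).

(** With at least one leader the hull is nonempty, so the infimum exists and
    [hull_dist] is the genuine infimum. *)
Lemma hull_dist_spec d k v Y : (1 <= k)%nat -> is_inf (hull_gaps d k v Y) (hull_dist d k v Y).
Proof.
  intros Hk. unfold hull_dist, Inf. apply epsilon_spec.
  set (E := fun r => hull_gaps d k v Y (- r)).
  assert (Hb : bound E).
  { exists 0. intros r [p [_ Hr]]. assert (0 <= - r) by (rewrite Hr; apply vnorm_nonneg). lra. }
  assert (Hn : exists r, E r).
  { exists (- vnorm d (fun c => v c - Y 0%nat c)). exists (Y 0%nat). split.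
    - apply hull_vertex; lia.
    - ring. }
  destruct (completeness E Hb Hn) as [m [Hm1 Hm2]].
  exists (- m). split.
  - intros r Hr. assert (E (- r)) by (unfold E; rewrite Ropp_involutive; auto).
    specialize (Hm1 _ H). lra.
  - intros b Hb'. assert (m <= - b).
    { apply Hm2. intros r Hr. specialize (Hb' _ Hr). lra. }
    lra.
Qed.

Lemma hull_dist_le d k v Y p : (1 <= k)%nat -> in_hull d k Y p ->
  hull_dist d k v Y <= vnorm d (fun c => v c - p c).
Proof. intros Hk Hp. apply (proj1 (hull_dist_spec d k v Y Hk)). exists p; auto. Qed.

Lemma hull_dist_nonneg d k v Y : (1 <= k)%nat -> 0 <= hull_dist d k v Y.
Proof.
  intros Hk. apply (proj2 (hull_dist_spec d k v Y Hk)). intros r [p [_ ->]].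
  apply vnorm_nonneg.
Qed.

Lemma hull_dist_approx d k v Y eps : (1 <= k)%nat -> 0 < eps ->
  exists p, in_hull d k Y p /\ vnorm d (fun c => v c - p c) < hull_dist d k v Y + eps.
Proof.
  intros Hk He. apply NNPP. intros Hn.
  assert (hull_dist d k v Y + eps <= hull_dist d k v Y).
  { apply (proj2 (hull_dist_spec d k v Y Hk)). intros r [p [Hp ->]].
    apply Rnot_lt_le. intros Hlt. apply Hn. exists p; auto. }
  lra.
Qed.

Lemma hull_dist_lip d k v v' Y : (1 <= k)%nat ->
  hull_dist d k v' Y <= hull_dist d k v Y + vnorm d (fun c => v' c - v c).
Proof.
  intros Hk. apply le_epsilon. intros eps He.
  destruct (hull_dist_approx d k v Y eps Hk He) as [p [Hp Hlt]].
  eapply Rle_trans; [apply (hull_dist_le _ _ _ _ p Hk Hp)|].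
  eapply Rle_trans.
  - rewrite (vnorm_ext d _ (fun c => (v' c - v c) + (v c - p c))) by (intros; ring).
    apply vnorm_triang.
  - lra.
Qed.

Lemma hull_dist_move_vertices d k v Y Y' B : (1 <= k)%nat ->
  (forall j, (j < k)%nat -> vnorm d (fun c => Y' j c - Y j c) <= B) ->
  hull_dist d k v Y' <= hull_dist d k v Y + B.
Proof.
  intros Hk HB. apply le_epsilon. intros eps He.
  destruct (hull_dist_approx d k v Y eps Hk He) as [p [[lam [Hl1 [Hl2 Hl3]]] Hlt]].
  set (p' := fun c => rsum k (fun j => lam j * Y' j c)).
  assert (Hin : in_hull d k Y' p') by (exists lam; auto).
  eapply Rle_trans; [apply (hull_dist_le _ _ _ _ _ Hk Hin)|].
  rewrite (vnorm_ext d _ (fun c => (v c - p c) + rsum k (fun j => lam j * (Y j c - Y' j c)))).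
  2:{ intros c Hc. unfold p'. rewrite Hl3 by auto.
      replace (rsum k (fun j => lam j * (Y j c - Y' j c))) with
        (rsum k (fun j => lam j * Y j c) + (-1) * rsum k (fun j => lam j * Y' j c)).
      - ring.
      - rewrite <- rsum_scal, <- rsum_plus. apply rsum_ext; intros; ring. }
  eapply Rle_trans; [apply vnorm_triang|].
  assert (rsum k (fun j => Rabs (lam j) * vnorm d (fun c => Y j c - Y' j c)) <= B).
  { replace B with (rsum k (fun j => lam j * B)) by (rewrite rsum_scal_r, Hl2; ring).
    apply rsum_le. intros j Hj. rewrite Rabs_right by (apply Rle_ge; auto).
    apply Rmult_le_compat_l; auto. rewrite vnorm_sym. auto. }
  pose proof (vnorm_sum d k lam (fun j c => Y j c - Y' j c)). simpl in H0. lra.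
Qed.

Lemma hull_dist_vertex d k Y j : (1 <= k)%nat -> (j < k)%nat -> hull_dist d k (Y j) Y <= 0.
Proof.
  intros Hk Hj.
  eapply Rle_trans; [apply (hull_dist_le _ _ _ _ (Y j) Hk (hull_vertex d k Y j Hj))|].
  rewrite vnorm_zero; [lra|]. intros; ring.
Qed.

Lemma hull_dist_convex d k Y N (al : nat -> R) (V : nat -> nat -> R) v' : (1 <= k)%nat ->
  (forall q, (q < N)%nat -> 0 <= al q) -> rsum N al = 1 ->
  (forall c, (c < d)%nat -> v' c = rsum N (fun q => al q * V q c)) ->
  hull_dist d k v' Y <= rsum N (fun q => al q * hull_dist d k (V q) Y).
Proof.
  intros Hk Hal Hs Hv. apply le_epsilon. intros eps He.
  assert (Hc : forall q, exists p, in_hull d k Y p /\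
     vnorm d (fun c => V q c - p c) < hull_dist d k (V q) Y + eps)
    by (intros; apply hull_dist_approx; auto).
  destruct (choice _ Hc) as [f Hf].
  assert (Hin : in_hull d k Y (fun c => rsum N (fun q => al q * f q c)))
    by (apply hull_comb; auto; intros; apply Hf).
  eapply Rle_trans; [apply (hull_dist_le _ _ _ _ _ Hk Hin)|].
  rewrite (vnorm_ext d _ (fun c => rsum N (fun q => al q * (V q c - f q c)))).
  2:{ intros c Hc'. rewrite Hv by auto.
      replace (rsum N (fun q => al q * (V q c - f q c))) with
        (rsum N (fun q => al q * V q c) + (-1) * rsum N (fun q => al q * f q c)).
      - ring.
      - rewrite <- rsum_scal, <- rsum_plus. apply rsum_ext; intros; ring. }
  eapply Rle_trans; [apply vnorm_sum|].
  replace (rsum N (fun q => al q * hull_dist d k (V q) Y) + eps) with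
    (rsum N (fun q => al q * (hull_dist d k (V q) Y + eps))).
  2:{ rewrite (rsum_ext _ _ (fun q => al q * hull_dist d k (V q) Y + eps * al q))
        by (intros; ring).
      rewrite rsum_plus, rsum_scal, Hs. ring. }
  apply rsum_le. intros q Hq. rewrite Rabs_right by (apply Rle_ge; auto).
  apply Rmult_le_compat_l; auto. left; apply Hf.
Qed.

(** Convexity for a combination of two finite families and one more point,
    obtained by concatenating the families. *)
Lemma hull_dist_convex3 d k Y N1 N2 (X1 X2 : nat -> nat -> R) (al1 al2 : nat -> R) (ga : R)
      (v p : nat -> R) : (1 <= k)%nat ->
  (forall q, (q < N1)%nat -> 0 <= al1 q) -> (forall j, (j < N2)%nat -> 0 <= al2 j) -> 0 <= ga ->
  rsum N1 al1 + rsum N2 al2 + ga = 1 ->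
  (forall c, (c < d)%nat ->
     p c = rsum N1 (fun q => al1 q * X1 q c) + rsum N2 (fun j => al2 j * X2 j c) + ga * v c) ->
  hull_dist d k p Y <= rsum N1 (fun q => al1 q * hull_dist d k (X1 q) Y)
                       + rsum N2 (fun j => al2 j * hull_dist d k (X2 j) Y)
                       + ga * hull_dist d k v Y.
Proof.
  intros Hk H1 H2 Hga Hs Hp.
  set (fam := fun q => if Nat.ltb q N1 then X1 q
                       else if Nat.ltb q (N1 + N2) then X2 (q - N1)%nat else v).
  set (al := fun q => if Nat.ltb q N1 then al1 q
                      else if Nat.ltb q (N1 + N2) then al2 (q - N1)%nat else ga).
  assert (Hsum : forall F : (nat -> R) -> R, rsum (S (N1 + N2)) (fun q => al q * F (fam q))
     = rsum N1 (fun q => al1 q * F (X1 q)) + rsum N2 (fun j => al2 j * F (X2 j)) + ga * F v).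
  { intros F. rewrite rsum_blocks.
    rewrite (rsum_ext N1 _ (fun q => al1 q * F (X1 q))).
    2:{ intros q Hq. unfold al, fam. rewrite (proj2 (Nat.ltb_lt q N1) Hq). reflexivity. }
    rewrite (rsum_ext N2 _ (fun j => al2 j * F (X2 j))).
    2:{ intros j Hj. unfold al, fam.
        rewrite (proj2 (Nat.ltb_ge (N1 + j) N1)), (proj2 (Nat.ltb_lt (N1 + j) (N1 + N2)))
          by lia.
        replace (N1 + j - N1)%nat with j by lia. reflexivity. }
    unfold al, fam. rewrite (proj2 (Nat.ltb_ge (N1 + N2) N1)), (proj2 (Nat.ltb_ge _ _))
      by lia. reflexivity. }
  pose proof (Hsum (fun p => hull_dist d k p Y)) as Hdist; cbv beta in Hdist.
  rewrite <- Hdist. apply hull_dist_convex; auto.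
  - intros q Hq. unfold al. destruct (Nat.ltb_spec q N1); [apply H1; auto|].
    destruct (Nat.ltb_spec q (N1 + N2)); [apply H2; lia|auto].
  - pose proof (Hsum (fun _ => 1)) as Hw; cbv beta in Hw.
    rewrite (rsum_ext _ al (fun q => al q * 1)) by (intros; ring).
    rewrite Hw, !rsum_scal_r. lra.
  - intros c Hc. pose proof (Hsum (fun p => p c)) as Hpt; cbv beta in Hpt.
    rewrite Hpt. auto.
Qed.

(** Convexity applied to one explicit Euler step of the consensus dynamics:
    moving [v] towards neighbours [X q] with weights [h A q] and towards the
    vertices [Y j] with weights [h B j] increases its distance to the hull by
    at most [h sum_q A q (dist(X q) - dist v)], as vertices are at distance 0. *)
Lemma hull_dist_euler_step d k Y N (X : nat -> nat -> R) (A B : nat -> R) (v p : nat -> R) h :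
  (1 <= k)%nat -> 0 <= h ->
  (forall q, (q < N)%nat -> 0 <= A q) -> (forall j, (j < k)%nat -> 0 <= B j) ->
  h * (rsum N A + rsum k B) <= 1 ->
  (forall c, (c < d)%nat -> p c = v c + h * (rsum N (fun q => A q * (X q c - v c))
                                             + rsum k (fun j => B j * (Y j c - v c)))) ->
  hull_dist d k p Y <= hull_dist d k v Y
    + h * rsum N (fun q => A q * (hull_dist d k (X q) Y - hull_dist d k v Y)).
Proof.
  intros Hk Hh HA HB Hstep Hp.
  assert (HSA : 0 <= rsum N A) by (apply rsum_nonneg; auto).
  assert (HSB : 0 <= rsum k B) by (apply rsum_nonneg; auto).
  assert (Hcomb := hull_dist_convex3 d k Y N k X Y (fun q => h * A q) (fun j => h * B j)
                     (1 - h * (rsum N A + rsum k B)) v p Hk).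
  rewrite !rsum_scal in Hcomb.
  assert (Hvert : rsum k (fun j => B j * hull_dist d k (Y j) Y) <= 0).
  { replace 0 with (rsum k (fun _ => 0)) by (rewrite rsum_const; ring).
    apply rsum_le. intros j Hj.
    pose proof (hull_dist_vertex d k Y j Hk Hj). pose proof (HB j Hj). nra. }
  assert (HBv : 0 <= h * rsum k B * hull_dist d k v Y)
    by (apply Rmult_le_pos; [nra|apply hull_dist_nonneg; auto]).
  rewrite (rsum_ext N (fun q => A q * (_ - _))
             (fun q => A q * hull_dist d k (X q) Y + (- hull_dist d k v Y) * A q))
    by (intros; ring).
  rewrite rsum_plus, rsum_scal.
  eapply Rle_trans.
  - apply Hcomb.
    + intros q Hq. apply Rmult_le_pos; auto.
    + intros j Hj. apply Rmult_le_pos; auto.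
    + lra.
    + ring.
    + intros c Hc. rewrite Hp by auto.
      rewrite (rsum_ext N (fun q => A q * (X q c - v c)) (fun q => A q * X q c + (- v c) * A q))
        by (intros; ring).
      rewrite (rsum_ext k (fun j => B j * (Y j c - v c)) (fun j => B j * Y j c + (- v c) * B j))
        by (intros; ring).
      rewrite (rsum_ext N (fun q => h * A q * X q c) (fun q => h * (A q * X q c)))
        by (intros; ring).
      rewrite (rsum_ext k (fun j => h * B j * Y j c) (fun j => h * (B j * Y j c)))
        by (intros; ring).
      rewrite !rsum_plus, !rsum_scal. ring.
  - rewrite (rsum_ext N (fun q => h * A q * _) (fun q => h * (A q * hull_dist d k (X q) Y)))
      by (intros; ring).
    rewrite (rsum_ext k (fun j => h * B j * _) (fun j => h * (B j * hull_dist d k (Y j) Y)))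
      by (intros; ring).
    rewrite !rsum_scal.
    assert (h * rsum k (fun j => B j * hull_dist d k (Y j) Y) <= 0) by nra.
    nra.
Qed.

Lemma max_hull_ge n d k X Y l : (l < n)%nat -> hull_dist d k (X l) Y <= max_hull_dist n d k X Y.
Proof.
  intros Hl. unfold max_hull_dist.
  assert (In l (seq 0 n)) by (apply in_seq; lia).
  induction (seq 0 n) as [|q s IH]; simpl in *; [tauto|].
  destruct H as [->|H]; [apply Rmax_l|]. eapply Rle_trans; [apply IH; auto|apply Rmax_r].
Qed.

Lemma max_hull_nonneg n d k X Y : 0 <= max_hull_dist n d k X Y.
Proof.
  unfold max_hull_dist. induction (seq 0 n); simpl; [lra|].
  eapply Rle_trans; [apply IHl|apply Rmax_r].
Qed.
(** ** A maximum principle on an interval *)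

Definition right_nonincr (H : R -> R) (t : R) : Prop :=
  exists del, 0 < del /\ forall s, t < s < t + del -> H s <= H t.

Lemma cont_on_sub a b a' b' H : a <= a' -> b' <= b -> cont_on a b H -> cont_on a' b' H.
Proof.
  intros H1 H2 Hc t Ht eps He. destruct (Hc t ltac:(lra) eps He) as [del [Hd Hs]].
  exists del; split; auto. intros s Hs' Hst. apply Hs; auto; lra.
Qed.

Lemma cont_on_below a b H t v : cont_on a b H -> a <= t < b -> H t < v ->
  exists del, 0 < del /\ forall s, t < s < t + del -> H s < v.
Proof.
  intros Hc Ht Hv. destruct (Hc t ltac:(lra) (v - H t) ltac:(lra)) as [del [Hd Hs]].
  exists (Rmin del (b - t)). split; [apply Rmin_glb_lt; lra|].
  intros s Hs'. pose proof (Rmin_l del (b - t)). pose proof (Rmin_r del (b - t)).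
  specialize (Hs s ltac:(lra) ltac:(rewrite Rabs_right; lra)). apply Rabs_def2 in Hs. lra.
Qed.

(** If [H] is continuous on [a,b] and right-nonincreasing on [a,b), then
    [H b <= H a]: the largest [s] with [H <= H a] on [a,s] cannot be [< b]. *)
Lemma nonincr_of_right_nonincr_closed a b H : a < b -> cont_on a b H ->
  (forall t, a <= t < b -> right_nonincr H t) -> H b <= H a.
Proof.
  intros Hab Hc Hf.
  set (S := fun s => a <= s <= b /\ forall r, a <= r <= s -> H r <= H a).
  assert (HSa : S a).
  { split; [lra|]. intros r Hr. replace r with a by lra. lra. }
  destruct (completeness S (ex_intro _ b (fun s Hs => proj2 (proj1 Hs))) (ex_intro _ a HSa))
    as [ts [Hub Hlub]].
  assert (Hts : a <= ts <= b) by (split; [apply Hub, HSa|apply Hlub; intros s [Hs _]; lra]).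
  assert (Hbelow : forall r, a <= r < ts -> H r <= H a).
  { intros r Hr. apply NNPP. intros Hneg.
    assert (ts <= r).
    { apply Hlub. intros s [Hs1 Hs2]. apply Rnot_lt_le. intros Hlt. apply Hneg.
      apply Hs2. lra. }
    lra. }
  assert (Hatts : H ts <= H a).
  { destruct (Req_dec ts a) as [->|Hne]; [lra|].
    apply Rnot_lt_le. intros Hlt.
    destruct (Hc ts Hts (H ts - H a) ltac:(lra)) as [del [Hd Hs]].
    set (r := Rmax a (ts - del / 2)).
    assert (a <= r < ts) by (unfold r; apply Rmax_case_strong; intros; lra).
    assert (Rabs (r - ts) < del)
      by (unfold r; apply Rmax_case_strong; intros; rewrite Rabs_left; lra).
    specialize (Hs r ltac:(lra) H1). specialize (Hbelow r H0).
    apply Rabs_def2 in Hs. lra. }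
  enough (ts = b) by (subst ts; auto).
  destruct (Req_dec ts b) as [|Hne]; auto. exfalso.
  destruct (Hf ts ltac:(lra)) as [del [Hd Hs]].
  set (s := ts + Rmin del (b - ts) / 2).
  assert (Hm : 0 < Rmin del (b - ts)) by (apply Rmin_glb_lt; lra).
  pose proof (Rmin_l del (b - ts)). pose proof (Rmin_r del (b - ts)).
  assert (S s).
  { unfold s. split; [lra|]. intros r Hr.
    destruct (Rlt_le_dec r ts); [apply Hbelow; lra|].
    destruct (Req_dec r ts) as [->|]; auto.
    assert (H r <= H ts) by (apply Hs; lra). lra. }
  specialize (Hub s H2). unfold s in Hub. lra.
Qed.

(** The same on the open interval, by continuity at [a]. *)
Lemma nonincr_of_right_nonincr a b H : a < b -> cont_on a b H ->
  (forall t, a < t < b -> right_nonincr H t) -> H b <= H a.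
Proof.
  intros Hab Hc Hf. apply Rnot_lt_le. intros Hlt.
  destruct (Hc a ltac:(lra) (H b - H a) ltac:(lra)) as [del [Hd Hs]].
  set (a' := a + Rmin del (b - a) / 2).
  assert (Hm : 0 < Rmin del (b - a)) by (apply Rmin_glb_lt; lra).
  pose proof (Rmin_l del (b - a)). pose proof (Rmin_r del (b - a)).
  assert (Hb' : H b <= H a').
  { apply nonincr_of_right_nonincr_closed; [unfold a'; lra| |].
    - apply (cont_on_sub a b); auto; unfold a'; lra.
    - intros t Ht. apply Hf. unfold a' in Ht. lra. }
  specialize (Hs a' ltac:(unfold a'; lra) ltac:(rewrite Rabs_right; unfold a'; lra)).
  apply Rabs_def2 in Hs. lra.
Qed.

(** ... and also when right-nonincrease fails on a finite set [E]: split the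
    interval at a point of [E] and induct on the size of [E]. *)
Lemma nonincr_except_finite E a b H : a <= b -> cont_on a b H ->
  (forall t, a < t < b -> ~ In t E -> right_nonincr H t) -> H b <= H a.
Proof.
  remember (length E) as N eqn:HN. assert (HE : (length E <= N)%nat) by lia. clear HN.
  revert E HE a b. induction N as [|N IH]; intros E HE a b Hab Hc Hf;
  (destruct (classic (exists e, In e E /\ a < e < b)) as [[e [He1 He2]]|Hno];
   [| destruct (Req_dec a b) as [->|Hne]; [lra|];
      apply nonincr_of_right_nonincr; [lra|auto|];
      intros t Ht; apply Hf; auto; intros Hin; apply Hno; exists t; auto]).
  - pose proof (remove_length_lt Req_dec_T E e He1). lia.
  - pose proof (remove_length_lt Req_dec_T E e He1).
    set (E' := remove Req_dec_T e E).
    assert (HE' : (length E' <= N)%nat) by (unfold E'; lia).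
    assert (Hf' : forall t, a < t < b -> t <> e -> ~ In t E' -> right_nonincr H t).
    { intros t Ht Hte Hin. apply Hf; [lra|]. intros Hin2. apply Hin.
      apply in_in_remove; auto. }
    assert (H e <= H a).
    { apply (IH E' HE'); [lra|apply (cont_on_sub a b); auto; lra|].
      intros t Ht Hin. apply Hf'; auto; lra. }
    assert (H b <= H e).
    { apply (IH E' HE'); [lra|apply (cont_on_sub a b); auto; lra|].
      intros t Ht Hin. apply Hf'; auto; lra. }
    lra.
Qed.

Lemma common_radius (P : nat -> R -> Prop) N :
  (forall q del del', 0 < del' <= del -> P q del -> P q del') ->
  (forall q, (q < N)%nat -> exists del, 0 < del /\ P q del) ->
  exists del, 0 < del /\ forall q, (q < N)%nat -> P q del.
Proof.
  intros Hm. induction N; intros H.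
  - exists 1. split; [lra|]. intros; lia.
  - destruct IHN as [d1 [Hd1 H1]]. { intros; apply H; lia. }
    destruct (H N ltac:(lia)) as [d2 [Hd2 H2]].
    exists (Rmin d1 d2). split; [apply Rmin_glb_lt; auto|].
    intros q Hq. destruct (Nat.eq_dec q N) as [->|].
    + apply (Hm _ d2); auto. split; [apply Rmin_glb_lt; auto|apply Rmin_r].
    + apply (Hm _ d1); [split; [apply Rmin_glb_lt; auto|apply Rmin_l]|]. apply H1; lia.
Qed.

Definition list_max (l : list nat) (F : nat -> R -> R) (s : R) : R :=
  fold_right Rmax 0 (map (fun q => F q s) l).

Lemma list_max_ge l F s q : In q l -> F q s <= list_max l F s.
Proof.
  unfold list_max. induction l as [|q' l IH]; simpl; [tauto|]. intros [->|Hin].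
  - apply Rmax_l.
  - eapply Rle_trans; [apply IH; auto|apply Rmax_r].
Qed.

Lemma list_max_nonneg l F s : 0 <= list_max l F s.
Proof.
  unfold list_max. induction l; simpl; [lra|].
  eapply Rle_trans; [apply IHl|apply Rmax_r].
Qed.

Lemma list_max_le l F s v : 0 <= v -> (forall q, In q l -> F q s <= v) -> list_max l F s <= v.
Proof.
  unfold list_max. induction l as [|q l IH]; simpl; intros Hv H; [lra|].
  apply Rmax_lub; [apply H; auto|apply IH; auto].
Qed.

Lemma Rmax_lip a b a' b' : Rabs (Rmax a b - Rmax a' b') <= Rmax (Rabs (a - a')) (Rabs (b - b')).
Proof.
  pose proof (Rmax_l (Rabs (a - a')) (Rabs (b - b'))).
  pose proof (Rmax_r (Rabs (a - a')) (Rabs (b - b'))).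
  pose proof (Rle_abs (a - a')). pose proof (Rle_abs (b - b')).
  pose proof (Rle_abs (- (a - a'))). pose proof (Rle_abs (- (b - b'))).
  rewrite Rabs_Ropp in H3, H4.
  apply Rabs_le.
  set (M := Rmax (Rabs (a - a')) (Rabs (b - b'))) in *. clearbody M.
  unfold Rmax. destruct (Rle_dec a b), (Rle_dec a' b'); lra.
Qed.

Lemma list_max_cont a b l F : (forall q, In q l -> cont_on a b (F q)) ->
  cont_on a b (list_max l F).
Proof.
  induction l as [|q l IH]; intros H t Ht eps He.
  - exists 1; split; [lra|]. intros. unfold list_max; simpl.
    rewrite Rminus_0_r, Rabs_R0; lra.
  - destruct (H q (or_introl eq_refl) t Ht eps He) as [d1 [Hd1 H1]].
    destruct (IH (fun f Hf => H f (or_intror Hf)) t Ht eps He) as [d2 [Hd2 H2]].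
    exists (Rmin d1 d2). split; [apply Rmin_glb_lt; auto|].
    intros s Hs Hst. unfold list_max; simpl. eapply Rle_lt_trans; [apply Rmax_lip|].
    pose proof (Rmin_l d1 d2). pose proof (Rmin_r d1 d2).
    apply Rmax_lub_lt; [apply H1|apply H2]; auto; lra.
Qed.

Lemma max_principle N (F : nat -> R -> R) E a b :
  (forall q, (q < N)%nat -> cont_on a b (F q)) ->
  (forall q, (q < N)%nat -> F q a <= 0) ->
  (forall r, a < r < b -> ~ In r E -> forall q, (q < N)%nat -> 0 <= F q r ->
     (forall q', (q' < N)%nat -> F q' r <= F q r) -> right_nonincr (F q) r) ->
  forall t, a <= t <= b -> forall q, (q < N)%nat -> F q t <= 0.
Proof.
  intros Hc H0 Hmax t Ht q Hq.
  set (G := list_max (seq 0 N) F).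
  assert (HinN : forall q', In q' (seq 0 N) <-> (q' < N)%nat)
    by (intros; rewrite in_seq; lia).
  assert (HG : G t <= G a).
  { apply (nonincr_except_finite E); [lra| |].
    { apply (cont_on_sub a b); [lra|lra|]. apply list_max_cont.
      intros q' Hq'. apply Hc, HinN; auto. }
    intros r Hr HrE.
    destruct (common_radius (fun q' del => forall s, r < s < r + del -> F q' s <= G r) N)
      as [del [Hdel Hall]].
    { intros q' del del' Hdd HP s Hs. apply HP. lra. }
    { intros q' Hq'.
      assert (HqG : F q' r <= G r) by (apply list_max_ge, HinN; auto).
      destruct (Rle_lt_or_eq_dec _ _ HqG) as [Hlt|Heq].
      - destruct (cont_on_below a b (F q') r (G r) (Hc q' Hq') ltac:(lra) Hlt)
          as [del [Hdel Hs]].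
        exists del. split; auto. intros s Hs'. left; auto.
      - destruct (Hmax r ltac:(lra) HrE q' Hq') as [del [Hdel Hs]].
        + rewrite Heq. apply list_max_nonneg.
        + intros q'' Hq''. rewrite Heq. apply list_max_ge, HinN; auto.
        + exists del. split; auto. intros s Hs'. rewrite <- Heq. auto. }
    exists del. split; auto. intros s Hs.
    apply list_max_le; [apply list_max_nonneg|]. intros q' Hq'. apply Hall; auto.
    apply HinN; auto. }
  assert (G a <= 0) by (apply list_max_le; [lra|]; intros q' Hq'; apply H0, HinN; auto).
  assert (F q t <= G t) by (apply list_max_ge, HinN; auto).
  lra.
Qed.

Definition upper_rate (f : R -> R) (r rho : R) : Prop :=
  forall eta, 0 < eta -> exists del, 0 < del /\
    forall h, 0 < h < del -> f (r + h) <= f r + h * (rho + eta).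

Definition lower_rate (g : R -> R) (r rho : R) : Prop :=
  exists del, 0 < del /\ forall h, 0 < h < del -> g r + h * rho <= g (r + h).

Lemma upper_rate_mono f r rho rho' : rho <= rho' -> upper_rate f r rho -> upper_rate f r rho'.
Proof.
  intros Hle Hf eta He. destruct (Hf eta He) as [del [Hd Hs]].
  exists del. split; auto. intros h Hh. specialize (Hs h Hh).
  assert (h * (rho + eta) <= h * (rho' + eta)) by (apply Rmult_le_compat_l; lra). lra.
Qed.

Lemma right_nonincr_of_rates f g r rho rho' : rho < rho' ->
  upper_rate f r rho -> lower_rate g r rho' -> right_nonincr (fun s => f s - g s) r.
Proof.
  intros Hlt Hf [dg [Hdg Hg]].
  destruct (Hf (rho' - rho) ltac:(lra)) as [df [Hdf Hf']].
  exists (Rmin df dg). split; [apply Rmin_glb_lt; auto|].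
  intros s Hs. pose proof (Rmin_l df dg). pose proof (Rmin_r df dg).
  specialize (Hf' (s - r) ltac:(lra)). specialize (Hg (s - r) ltac:(lra)).
  replace (r + (s - r)) with s in * by ring.
  replace (rho + (rho' - rho)) with rho' in Hf' by ring. lra.
Qed.

(** ** The comparison function xi *)

Definition xi_tail (c2 K tau s : R) : R := 1 - c2 * exp (- (K * (s - tau))).

(** [xi_fun c K tau s] is [1 - c s] for [s <= tau] and [xi_tail (c tau) K tau s]
    for [s >= tau]; the min/max form makes continuity evident. *)
Definition xi_fun (c K tau s : R) : R :=
  (1 - c * Rmin s tau) + xi_tail (c * tau) K tau (Rmax s tau) - (1 - c * tau).

Lemma xi_fun_left c K tau s : s <= tau -> xi_fun c K tau s = 1 - c * s.
Proof.
  intros H. unfold xi_fun, xi_tail. rewrite Rmin_left, Rmax_right by lra.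
  replace (tau - tau) with 0 by ring. rewrite Rmult_0_r, Ropp_0, exp_0. ring.
Qed.

Lemma xi_fun_right c K tau s : tau <= s -> xi_fun c K tau s = xi_tail (c * tau) K tau s.
Proof. intros H. unfold xi_fun. rewrite Rmin_right, Rmax_left by lra. ring. Qed.

Lemma exp_le1 x : x <= 0 -> exp x <= 1.
Proof.
  intros H. rewrite <- exp_0. destruct (Req_dec x 0) as [->|]; [lra|].
  left; apply exp_increasing; lra.
Qed.

Lemma xi_tail_shift c2 K tau u h :
  xi_tail c2 K tau (u + h) = 1 - (c2 * exp (- (K * (u - tau)))) * exp (- (K * h)).
Proof. unfold xi_tail. rewrite Rmult_assoc, <- exp_plus. do 3 f_equal. ring. Qed.

Lemma xi_tail_strict c2 K tau u v : 0 < c2 -> 0 < K -> tau <= u -> u < v ->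
  xi_tail c2 K tau u < xi_tail c2 K tau v.
Proof.
  intros Hc HK Hu Huv. unfold xi_tail.
  assert (exp (- (K * (v - tau))) < exp (- (K * (u - tau)))) by (apply exp_increasing; nra).
  nra.
Qed.

Lemma xi_tail_range c2 K tau u : 0 < c2 -> 0 < K -> tau <= u -> 1 - c2 <= xi_tail c2 K tau u < 1.
Proof.
  intros Hc HK Hu. unfold xi_tail.
  assert (0 < exp (- (K * (u - tau))) <= 1) by (split; [apply exp_pos|apply exp_le1; nra]).
  nra.
Qed.

Lemma xi_tail_upper c2 K tau u v : 0 <= c2 -> 0 < K -> tau <= u -> u <= v ->
  xi_tail c2 K tau v - xi_tail c2 K tau u <= c2 * K * (v - u).
Proof.
  intros Hc HK Hu Huv. replace v with (u + (v - u)) by ring. rewrite xi_tail_shift.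
  unfold xi_tail. set (q := exp (- (K * (u - tau)))).
  assert (0 < q <= 1) by (split; [apply exp_pos|apply exp_le1; nra]).
  pose proof (exp_ineq1_le (- (K * (u + (v - u) - u)))).
  replace (u + (v - u) - u) with (v - u) in * by ring.
  assert (exp (- (K * (v - u))) <= 1) by (apply exp_le1; nra).
  replace (1 - c2 * q * exp (- (K * (v - u))) - (1 - c2 * q))
    with (c2 * q * (1 - exp (- (K * (v - u))))) by ring.
  assert (c2 * q <= c2) by nra.
  nra.
Qed.

Lemma xi_tail_lower c2 K tau u h eta : 0 <= c2 <= 1 -> 0 < K -> tau <= u -> 0 < h ->
  0 < eta -> h <= eta / (K * K) ->
  xi_tail c2 K tau (u + h) - xi_tail c2 K tau u >= h * (K * (1 - xi_tail c2 K tau u) - eta).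
Proof.
  intros Hc HK Hu Hh He Hhe. rewrite xi_tail_shift. unfold xi_tail.
  set (q := c2 * exp (- (K * (u - tau)))).
  assert (Hq : 0 <= q <= 1).
  { assert (0 < exp (- (K * (u - tau))) <= 1) by (split; [apply exp_pos|apply exp_le1; nra]).
    unfold q; split; nra. }
  set (e := exp (- (K * h))).
  assert (He1 : e * (1 + K * h) <= 1).
  { unfold e. pose proof (exp_ineq1_le (K * h)).
    assert (exp (- (K * h)) * exp (K * h) = 1)
      by (rewrite <- exp_plus; replace (- (K * h) + K * h) with 0 by ring; apply exp_0).
    assert (0 < exp (- (K * h))) by apply exp_pos. nra. }
  assert (He0 : 0 < e) by apply exp_pos.
  assert (Hkh : K * K * h <= eta).
  { assert (0 < K * K) by nra. replace eta with (K * K * (eta / (K * K))) by (field; lra).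
    apply Rmult_le_compat_l; lra. }
  replace (1 - q * e - (1 - q)) with (q * (1 - e)) by ring.
  replace (1 - (1 - q)) with q by ring.
  assert (A1 : q * (1 - e) * (1 + K * h) >= q * K * h) by nra.
  assert (A2 : h * (K * q - eta) * (1 + K * h) <= q * K * h).
  { assert (K * K * h * q <= K * K * h) by (assert (0 <= K * K * h) by nra; nra).
    assert (h * (K * K * h * q) <= h * eta) by (apply Rmult_le_compat_l; lra).
    assert (h * eta * (K * h) >= 0) by (apply Rle_ge; repeat apply Rmult_le_pos; lra).
    replace (h * (K * q - eta) * (1 + K * h))
      with (q * K * h + h * (K * K * h * q) - h * eta - h * eta * (K * h)) by ring.
    lra. }
  assert (0 < 1 + K * h) by nra.
  apply Rle_ge. apply (Rmult_le_reg_r (1 + K * h)); auto. lra.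
Qed.

Lemma xi_tail_lip c2 K tau u v : 0 < c2 -> 0 < K -> tau <= u -> tau <= v ->
  Rabs (xi_tail c2 K tau v - xi_tail c2 K tau u) <= c2 * K * Rabs (v - u).
Proof.
  intros Hc HK Hu Hv. destruct (Rle_dec u v).
  - assert (xi_tail c2 K tau u <= xi_tail c2 K tau v).
    { destruct (Req_dec u v) as [->|]; [lra|]. left; apply xi_tail_strict; auto; lra. }
    rewrite (Rabs_right (v - u)) by lra. rewrite Rabs_right by lra.
    apply xi_tail_upper; lra.
  - assert (xi_tail c2 K tau v < xi_tail c2 K tau u) by (apply xi_tail_strict; auto; lra).
    rewrite (Rabs_left (v - u)) by lra. rewrite Rabs_left by lra.
    pose proof (xi_tail_upper c2 K tau v u ltac:(lra) HK Hv ltac:(lra)). lra.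
Qed.

Lemma Rmin_lip a b t : Rabs (Rmin a t - Rmin b t) <= Rabs (a - b).
Proof.
  apply Rabs_le. pose proof (Rle_abs (a - b)). pose proof (Rle_abs (- (a - b))).
  rewrite Rabs_Ropp in H0. unfold Rmin; destruct (Rle_dec a t); destruct (Rle_dec b t); lra.
Qed.

Lemma Rmax_lip_l a b t : Rabs (Rmax a t - Rmax b t) <= Rabs (a - b).
Proof.
  apply Rabs_le. pose proof (Rle_abs (a - b)). pose proof (Rle_abs (- (a - b))).
  rewrite Rabs_Ropp in H0. unfold Rmax; destruct (Rle_dec a t); destruct (Rle_dec b t); lra.
Qed.

(** xi_fun is Lipschitz with constant [c + c tau K], hence continuous. *)
Lemma xi_fun_cont c K tau lo hi : 0 < c -> 0 < K -> 0 < tau -> cont_on lo hi (xi_fun c K tau).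
Proof.
  intros Hc HK Ht t Ht' eps He.
  assert (Hc2 : 0 < c * tau) by nra.
  set (L := c + c * tau * K + 1).
  assert (HL : 0 < L) by (unfold L; nra).
  exists (eps / L). split; [apply Rdiv_lt_0_compat; lra|].
  intros s Hs Hst. unfold xi_fun.
  replace (1 - c * Rmin s tau + xi_tail (c * tau) K tau (Rmax s tau) - (1 - c * tau) -
    (1 - c * Rmin t tau + xi_tail (c * tau) K tau (Rmax t tau) - (1 - c * tau)))
    with ((- c) * (Rmin s tau - Rmin t tau)
          + (xi_tail (c * tau) K tau (Rmax s tau) - xi_tail (c * tau) K tau (Rmax t tau)))
    by ring.
  eapply Rle_lt_trans; [apply Rabs_triang|]. rewrite Rabs_mult, Rabs_Ropp, Rabs_right by lra.
  pose proof (Rmin_lip s t tau). pose proof (Rmax_lip_l s t tau).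
  pose proof (xi_tail_lip (c * tau) K tau (Rmax t tau) (Rmax s tau) Hc2 HK
                (Rmax_r _ _) (Rmax_r _ _)).
  assert (Rabs (s - t) * L < eps).
  { apply (Rmult_lt_compat_r L) in Hst; auto. unfold Rdiv in Hst.
    rewrite Rmult_assoc, Rinv_l, Rmult_1_r in Hst by lra. lra. }
  assert (0 <= Rabs (s - t)) by apply Rabs_pos.
  assert (c * Rabs (Rmin s tau - Rmin t tau) <= c * Rabs (s - t))
    by (apply Rmult_le_compat_l; lra).
  assert (c * tau * K * Rabs (Rmax s tau - Rmax t tau) <= c * tau * K * Rabs (s - t))
    by (apply Rmult_le_compat_l; nra).
  unfold L in *. nra.
Qed.

Lemma xi_fun_le_1 c K tau s : 0 < c -> 0 < K -> 0 < tau -> 0 <= s -> xi_fun c K tau s <= 1.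
Proof.
  intros Hc HK Ht Hs. destruct (Rle_dec s tau).
  - rewrite xi_fun_left by auto. nra.
  - rewrite xi_fun_right by lra.
    pose proof (xi_tail_range (c * tau) K tau s ltac:(nra) HK ltac:(lra)). lra.
Qed.

Lemma xi_fun_shape c K tau T : 0 < c -> 0 < K -> 0 < tau -> tau < T -> c * tau < 1 ->
  cont_on 0 T (xi_fun c K tau) /\
  (forall s, 0 <= s <= T -> 0 < xi_fun c K tau s <= 1) /\
  xi_fun c K tau 0 = 1 /\
  (forall s1 s2, 0 <= s1 -> s1 < s2 -> s2 <= tau -> xi_fun c K tau s2 < xi_fun c K tau s1) /\
  (forall s1 s2, tau <= s1 -> s1 < s2 -> s2 <= T -> xi_fun c K tau s1 < xi_fun c K tau s2) /\
  xi_fun c K tau T < 1.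
Proof.
  intros Hc HK Ht HT Hct.
  assert (Hc2 : 0 < c * tau) by nra.
  split; [apply xi_fun_cont; auto|split; [|split; [|split; [|split]]]].
  - intros s Hs. split; [|apply xi_fun_le_1; lra]. destruct (Rle_dec s tau).
    + rewrite xi_fun_left by auto. nra.
    + rewrite xi_fun_right by lra.
      pose proof (xi_tail_range (c * tau) K tau s Hc2 HK ltac:(lra)). lra.
  - rewrite xi_fun_left by lra. ring.
  - intros s1 s2 H1 H2 H3. rewrite !xi_fun_left by lra. nra.
  - intros s1 s2 H1 H2 H3. rewrite !xi_fun_right by lra. apply xi_tail_strict; auto.
  - rewrite xi_fun_right by lra. apply xi_tail_range; auto; lra.
Qed.

Lemma xi_fun_tail_growth c K tau s h eta : 0 < c -> 0 < K -> c * tau <= 1 -> 0 <= tau ->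
  tau <= s -> 0 < h -> 0 < eta -> h <= eta / (K * K) ->
  xi_fun c K tau (s + h) - xi_fun c K tau s >= h * (K * (1 - xi_fun c K tau s) - eta).
Proof.
  intros Hc HK Hct Htau Hs Hh He Hhe.
  rewrite !xi_fun_right by lra. apply xi_tail_lower; auto. split; nra.
Qed.

(** The slope of xi on [0, tau]: with [c] below, the pull of the persistent arc
    [a_lo (mu0 - xi)] together with the worst push [K (1 - xi)] of the other
    neighbours is [<= -c] while [xi] decreases from [1] to [1 - c tau > mu0]. *)
Definition contraction_rate (a_lo K tau mu0 : R) : R :=
  a_lo * (1 - mu0) / (1 + (a_lo + K) * tau).

Lemma contraction_rate_spec a_lo K tau mu0 :
  0 < a_lo -> 0 < K -> 0 < tau -> 0 < mu0 < 1 ->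
  let c := contraction_rate a_lo K tau mu0 in
  0 < c /\ c * tau < 1 - mu0 /\
  forall s, 0 <= s <= tau -> a_lo * mu0 + K + c <= (a_lo + K) * (1 - c * s).
Proof.
  intros Ha HK Ht Hmu c.
  assert (HA : 0 < 1 + (a_lo + K) * tau) by nra.
  assert (Hc : 0 < c) by (unfold c, contraction_rate; apply Rdiv_lt_0_compat; nra).
  assert (Hcdef : c * (1 + (a_lo + K) * tau) = a_lo * (1 - mu0))
    by (unfold c, contraction_rate; field; lra).
  assert (Hct : c * tau < 1 - mu0).
  { assert (0 < c * K * tau) by (apply Rmult_lt_0_compat; [apply Rmult_lt_0_compat|]; lra).
    assert (a_lo * (c * tau) < a_lo * (1 - mu0)).
    { rewrite <- Hcdef. replace (c * (1 + (a_lo + K) * tau))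
        with (c + a_lo * (c * tau) + c * K * tau) by ring. lra. }
    apply (Rmult_lt_reg_l a_lo); auto. }
  split; [|split]; auto.
  intros s Hs. assert (c * s <= c * tau) by (apply Rmult_le_compat_l; lra).
  assert ((a_lo + K) * (c * s) <= (a_lo + K) * (c * tau)) by (apply Rmult_le_compat_l; lra).
  nra.
Qed.

(** ** The distance of a follower to the leaders' hull along trajectories *)

Lemma vector_derivative_approx d (f : R -> nat -> R) (g : nat -> R) t :
  (forall c, (c < d)%nat -> derivable_pt_lim (fun s => f s c) t (g c)) ->
  forall eps, 0 < eps -> exists del, 0 < del /\ forall h, 0 < h < del ->
    vnorm d (fun c => f (t + h) c - f t c - h * g c) <= h * eps.
Proof.
  intros Hd eps He.
  assert (HdR : 0 <= INR d) by apply pos_INR.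
  set (e' := eps / (INR d + 1)).
  assert (He' : 0 < e') by (unfold e'; apply Rdiv_lt_0_compat; lra).
  assert (Hde : INR d * e' <= eps).
  { unfold e'. replace (INR d * (eps / (INR d + 1))) with (eps * (INR d / (INR d + 1)))
      by (field; lra).
    assert (INR d / (INR d + 1) <= 1).
    { apply (Rmult_le_reg_r (INR d + 1)); [lra|]. unfold Rdiv.
      rewrite Rmult_assoc, Rinv_l by lra. lra. }
    nra. }
  destruct (common_radius (fun c del => forall h, 0 < h < del ->
              Rabs (f (t + h) c - f t c - h * g c) <= h * e') d) as [del [Hdel Hall]].
  - intros c del del' Hdd HP h Hh. apply HP. lra.
  - intros c Hc. destruct (Hd c Hc e' He') as [[del Hdel0] Hdel].
    exists del. split; auto. intros h Hh.
    assert (Habs : Rabs h < del) by (rewrite Rabs_right; lra).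
    specialize (Hdel h ltac:(lra) Habs). simpl in Hdel.
    replace (f (t + h) c - f t c - h * g c) with (h * ((f (t + h) c - f t c) / h - g c))
      by (field; lra).
    rewrite Rabs_mult, Rabs_right by lra. apply Rmult_le_compat_l; lra.
  - exists del. split; auto. intros h Hh.
    eapply Rle_trans; [apply vnorm_le_abs|].
    eapply Rle_trans; [apply (rsum_le _ _ (fun _ => h * e')); intros; apply Hall; auto|].
    rewrite rsum_const. nra.
Qed.

Lemma vector_step_near d (f : R -> nat -> R) (g g1 : nat -> R) t Z :
  (forall c, (c < d)%nat -> derivable_pt_lim (fun s => f s c) t (g c)) ->
  vnorm d (fun c => g c - g1 c) <= Z ->
  forall eps, 0 < eps -> exists del, 0 < del /\ forall h, 0 < h < del ->
    vnorm d (fun c => f (t + h) c - f t c - h * g1 c) <= h * (Z + eps).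
Proof.
  intros Hd HZ eps He.
  destruct (vector_derivative_approx d f g t Hd eps He) as [del [Hdel Happrox]].
  exists del. split; auto. intros h Hh.
  rewrite (vnorm_ext d _ (fun c => h * (g c - g1 c) + (f (t + h) c - f t c - h * g c)))
    by (intros; ring).
  eapply Rle_trans; [apply vnorm_triang|].
  rewrite vnorm_scal, Rabs_right by lra.
  pose proof (Happrox h Hh).
  assert (h * vnorm d (fun c => g c - g1 c) <= h * Z) by (apply Rmult_le_compat_l; lra).
  lra.
Qed.

Definition hull_drive (n d k : nat) (sg : R -> digraph)
  (a : nat -> nat -> (nat -> nat -> R) -> (nat -> nat -> R) -> R -> R)
  (x y : R -> nat -> nat -> R) (l : nat) (t : R) : R :=
  rsum n (fun q => if sg t (Fol q) (Fol l)
                   then a l q (x t) (y t) t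
                        * (hull_dist d k (x t q) (y t) - hull_dist d k (x t l) (y t))
                   else 0).

(** Over a short step [h], the distance of follower [l] to the moving hull
    exceeds the distance of its undisturbed Euler step [x_l + h (x_l' - w_l)]
    to the current hull by at most [h (2 Z + eta)]: the leaders move by at most
    [h Z] each and the disturbance contributes at most [h Z]. *)
Lemma hull_dist_near_euler n k d sg a b u w (x y : R -> nat -> nat -> R) Z l t :
  (1 <= k)%nat ->
  (forall c, (c < d)%nat ->
     derivable_pt_lim (fun s => x s l c) t (follower_rhs n k sg a b w x y l c t)) ->
  (forall j c, (j < k)%nat -> (c < d)%nat ->
     derivable_pt_lim (fun s => y s j c) t (u j (y t) t c)) ->
  vnorm d (w l t) <= Z -> (forall j, (j < k)%nat -> vnorm d (u j (y t) t) <= Z) ->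
  forall eta, 0 < eta -> exists del, 0 < del /\ forall h, 0 < h < del ->
    hull_dist d k (x (t + h) l) (y (t + h))
    <= hull_dist d k (fun c => x t l c + h * (follower_rhs n k sg a b w x y l c t - w l t c)) (y t)
       + h * (2 * Z + eta).
Proof.
  intros Hk Hdx Hdy HZw HZu eta Heta.
  set (e := fun c => follower_rhs n k sg a b w x y l c t - w l t c).
  destruct (vector_step_near d (fun s c => x s l c) _ e t Z Hdx
              ltac:(rewrite (vnorm_ext d _ (w l t)) by (intros; unfold e; ring); auto)
              (eta / 2) ltac:(lra)) as [dx [Hdx0 Hx]].
  destruct (common_radius (fun j del => forall h, 0 < h < del ->
      vnorm d (fun c => y (t + h) j c - y t j c - h * 0) <= h * (Z + eta / 2)) k)
    as [dy [Hdy0 Hy]].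
  { intros j del del' Hdd HP h Hh. apply HP; lra. }
  { intros j Hj.
    apply (vector_step_near d (fun s c => y s j c) (u j (y t) t) (fun _ => 0) t Z);
      [auto| |lra].
    rewrite (vnorm_ext d _ (u j (y t) t)) by (intros; ring). auto. }
  exists (Rmin dx dy). split; [apply Rmin_glb_lt; auto|]. intros h Hh.
  pose proof (Rmin_l dx dy). pose proof (Rmin_r dx dy).
  assert (Hleaders : hull_dist d k (x (t + h) l) (y (t + h))
                     <= hull_dist d k (x (t + h) l) (y t) + h * (Z + eta / 2)).
  { apply hull_dist_move_vertices; auto. intros j Hj.
    rewrite (vnorm_ext d _ (fun c => y (t + h) j c - y t j c - h * 0)) by (intros; ring).
    apply Hy; auto; lra. }
  assert (Hfollower : hull_dist d k (x (t + h) l) (y t)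
                      <= hull_dist d k (fun c => x t l c + h * e c) (y t) + h * (Z + eta / 2)).
  { eapply Rle_trans; [apply (hull_dist_lip d k (fun c => x t l c + h * e c)); auto|].
    rewrite (vnorm_ext d _ (fun c => x (t + h) l c - x t l c - h * e c)) by (intros; ring).
    apply Rplus_le_compat_l, Hx. lra. }
  cbv beta delta [e] in Hfollower. lra.
Qed.

(** The differential inequality  D^+ V_l <= drive + 2 Z  at a point where
    (5) holds, by convexity applied to the undisturbed Euler step. *)
Lemma hull_dist_rate n k d sg a b u w (x y : R -> nat -> nat -> R) Z l t :
  (1 <= k)%nat ->
  (forall q, (q < n)%nat -> 0 <= a l q (x t) (y t) t) ->
  (forall j, (j < k)%nat -> 0 <= b l j (x t) (y t) t) ->
  (forall c, (c < d)%nat ->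
     derivable_pt_lim (fun s => x s l c) t (follower_rhs n k sg a b w x y l c t)) ->
  (forall j c, (j < k)%nat -> (c < d)%nat ->
     derivable_pt_lim (fun s => y s j c) t (u j (y t) t c)) ->
  vnorm d (w l t) <= Z -> (forall j, (j < k)%nat -> vnorm d (u j (y t) t) <= Z) ->
  upper_rate (fun s => hull_dist d k (x s l) (y s)) t (hull_drive n d k sg a x y l t + 2 * Z).
Proof.
  intros Hk Ha Hb Hdx Hdy HZw HZu eta Heta. cbv beta.
  set (A := fun q => if sg t (Fol q) (Fol l) then a l q (x t) (y t) t else 0).
  set (B := fun j => if sg t (Lead j) (Fol l) then b l j (x t) (y t) t else 0).
  assert (HA : forall q, (q < n)%nat -> 0 <= A q)
    by (intros q Hq; unfold A; destruct (sg t _ _); [apply Ha; auto|lra]).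
  assert (HB : forall j, (j < k)%nat -> 0 <= B j)
    by (intros j Hj; unfold B; destruct (sg t _ _); [apply Hb; auto|lra]).
  assert (HS : 0 <= rsum n A + rsum k B)
    by (pose proof (rsum_nonneg n A HA); pose proof (rsum_nonneg k B HB); lra).
  destruct (hull_dist_near_euler n k d sg a b u w x y Z l t Hk Hdx Hdy HZw HZu eta Heta)
    as [del0 [Hdel0 Hnear]].
  (* a step short enough for the Euler weights h A_q, h B_j to sum to at most 1 *)
  set (del := Rmin del0 (1 / (rsum n A + rsum k B + 1))).
  assert (Hdel : 0 < del) by (apply Rmin_glb_lt; [auto|apply Rdiv_lt_0_compat; lra]).
  assert (Hdel_S : del * (rsum n A + rsum k B + 1) <= 1).
  { unfold del. eapply Rle_trans; [apply Rmult_le_compat_r; [lra|apply Rmin_r]|].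
    right. field. lra. }
  assert (Hdel0' : del <= del0) by apply Rmin_l.
  exists del. split; auto. intros h Hh.
  assert (Hstep : h * (rsum n A + rsum k B) <= 1) by nra.
  eapply Rle_trans; [apply Hnear; lra|].
  assert (Hdrive : rsum n (fun q => A q * (hull_dist d k (x t q) (y t)
                                           - hull_dist d k (x t l) (y t)))
                   = hull_drive n d k sg a x y l t).
  { apply rsum_ext. intros q _. unfold A. destruct (sg t _ _); ring. }
  rewrite <- Hdrive.
  enough (hull_dist d k (fun c => x t l c + h * (follower_rhs n k sg a b w x y l c t - w l t c))
            (y t) <= hull_dist d k (x t l) (y t)
                     + h * rsum n (fun q => A q * (hull_dist d k (x t q) (y t)
                                                   - hull_dist d k (x t l) (y t)))) by lra.
  apply (hull_dist_euler_step d k (y t) n (x t) A B); auto; [lra|].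
  intros c Hc. unfold follower_rhs.
  rewrite (rsum_ext n _ (fun q => A q * (x t q c - x t l c)))
    by (intros q _; unfold A; destruct (sg t _ _); ring).
  rewrite (rsum_ext k _ (fun j => B j * (y t j c - x t l c)))
    by (intros j _; unfold B; destruct (sg t _ _); ring).
  ring.
Qed.

Lemma cont_vectors_close N d (f : R -> nat -> nat -> R) t e :
  (forall j c, (j < N)%nat -> (c < d)%nat -> cont_nonneg (fun s => f s j c)) ->
  0 <= t -> 0 < e -> exists del, 0 < del /\ forall s, 0 <= s -> Rabs (s - t) < del ->
    forall j, (j < N)%nat -> vnorm d (fun c => f s j c - f t j c) <= INR d * e.
Proof.
  intros Hf Ht He.
  destruct (common_radius (fun j del => forall c, (c < d)%nat -> forall s, 0 <= s ->
              Rabs (s - t) < del -> Rabs (f s j c - f t j c) < e) N) as [del [Hdel Hall]].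
  { intros j del del' Hdd HP c Hc s Hs Hst. apply HP; auto; lra. }
  { intros j Hj. apply (common_radius (fun c del => forall s, 0 <= s -> Rabs (s - t) < del ->
                                         Rabs (f s j c - f t j c) < e)).
    - intros c del del' Hdd HP s Hs Hst. apply HP; auto; lra.
    - intros c Hc. destruct (Hf j c Hj Hc t Ht e He) as [del [Hdel Hdel']].
      exists del; split; [lra|]. intros s Hs Hst. apply Hdel'; auto. }
  exists del. split; auto. intros s Hs Hst j Hj.
  apply vnorm_small; [lra|]. intros c Hc. apply Hall; auto.
Qed.

(** Continuity of [t |-> |x_l(t)|_{L(y(t))}]: the distance is 1-Lipschitz in
    the point and in the vertices. *)
Lemma hull_dist_cont k d (x y : R -> nat -> nat -> R) l a0 b0 : (1 <= k)%nat -> 0 <= a0 ->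
  (forall c, (c < d)%nat -> cont_nonneg (fun t => x t l c)) ->
  (forall j c, (j < k)%nat -> (c < d)%nat -> cont_nonneg (fun t => y t j c)) ->
  cont_on a0 b0 (fun t => hull_dist d k (x t l) (y t)).
Proof.
  intros Hk Ha0 Hx Hy t Ht eps He.
  assert (Hd : 0 <= INR d) by apply pos_INR.
  set (e := eps / (2 * (INR d + 1))).
  assert (He0 : 0 < e) by (unfold e; apply Rdiv_lt_0_compat; lra).
  assert (Hde : 2 * (INR d * e) < eps).
  { unfold e. replace (2 * (INR d * (eps / (2 * (INR d + 1)))))
      with (eps - eps / (INR d + 1)) by (field; lra).
    assert (0 < eps / (INR d + 1)) by (apply Rdiv_lt_0_compat; lra). lra. }
  destruct (cont_vectors_close 1 d (fun s _ => x s l) t e (fun _ c _ Hc => Hx c Hc)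
              ltac:(lra) He0) as [dx [Hdx0 Hdx]].
  destruct (cont_vectors_close k d y t e Hy ltac:(lra) He0) as [dy [Hdy0 Hdy]].
  exists (Rmin dx dy). split; [apply Rmin_glb_lt; auto|].
  intros s Hs Hst. pose proof (Rmin_l dx dy). pose proof (Rmin_r dx dy).
  assert (HX := Hdx s ltac:(lra) ltac:(lra) 0%nat ltac:(lia)). cbv beta in HX.
  assert (HY : forall j, (j < k)%nat -> vnorm d (fun c => y s j c - y t j c) <= INR d * e)
    by (intros; apply Hdy; auto; lra).
  assert (HY' : forall j, (j < k)%nat -> vnorm d (fun c => y t j c - y s j c) <= INR d * e)
    by (intros j Hj; rewrite vnorm_sym; auto).
  pose proof (hull_dist_move_vertices d k (x s l) (y t) (y s) _ Hk HY) as Hup1.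
  pose proof (hull_dist_lip d k (x t l) (x s l) (y t) Hk) as Hup2.
  pose proof (hull_dist_move_vertices d k (x t l) (y s) (y t) _ Hk HY') as Hdown1.
  pose proof (hull_dist_lip d k (x s l) (x t l) (y s) Hk) as Hdown2.
  rewrite vnorm_sym in Hdown2.
  apply Rabs_def1; lra.
Qed.

Lemma z_norm_bounds n k d u w y t :
  (forall i, (i < n)%nat -> vnorm d (w i t) <= z_norm n k d u w y t) /\
  (forall j, (j < k)%nat -> vnorm d (u j (y t) t) <= z_norm n k d u w y t).
Proof.
  assert (Hsq : forall (F : nat -> nat -> R) q, 0 <= rsum d (fun c => F q c ^ 2))
    by (intros; apply rsum_nonneg; intros; apply pow2_ge_0).
  assert (HU : 0 <= rsum k (fun j => rsum d (fun c => u j (y t) t c ^ 2)))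
    by (apply rsum_nonneg; intros; apply (Hsq (fun j c => u j (y t) t c))).
  assert (HW : 0 <= rsum n (fun i => rsum d (fun c => w i t c ^ 2)))
    by (apply rsum_nonneg; intros; apply (Hsq (fun i c => w i t c))).
  split.
  - intros i Hi. unfold vnorm, z_norm. apply sqrt_le_1_alt.
    pose proof (rsum_term_le n (fun i => rsum d (fun c => w i t c ^ 2)) i
                  (fun q _ => Hsq (fun i c => w i t c) q) Hi). cbv beta in H. lra.
  - intros j Hj. unfold vnorm, z_norm. apply sqrt_le_1_alt.
    pose proof (rsum_term_le k (fun j => rsum d (fun c => u j (y t) t c ^ 2)) j
                  (fun q _ => Hsq (fun j c => u j (y t) t c) q) Hj). cbv beta in H. lra.
Qed.

Lemma cont_on_minus a b f g : cont_on a b f -> cont_on a b g -> cont_on a b (fun s => f s - g s).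
Proof.
  intros Hf Hg t Ht eps He.
  destruct (Hf t Ht (eps/2) ltac:(lra)) as [d1 [Hd1 H1]].
  destruct (Hg t Ht (eps/2) ltac:(lra)) as [d2 [Hd2 H2]].
  exists (Rmin d1 d2). split; [apply Rmin_glb_lt; auto|]. intros s Hs Hst.
  specialize (H1 s Hs ltac:(pose proof (Rmin_l d1 d2); lra)).
  specialize (H2 s Hs ltac:(pose proof (Rmin_r d1 d2); lra)).
  replace (f s - g s - (f t - g t)) with ((f s - f t) - (g s - g t)) by ring.
  eapply Rle_lt_trans; [apply Rabs_triang|]. rewrite Rabs_Ropp. lra.
Qed.

Lemma cont_on_plus a b f g : cont_on a b f -> cont_on a b g -> cont_on a b (fun s => f s + g s).
Proof.
  intros Hf Hg t Ht eps He.
  destruct (Hf t Ht (eps/2) ltac:(lra)) as [d1 [Hd1 H1]].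
  destruct (Hg t Ht (eps/2) ltac:(lra)) as [d2 [Hd2 H2]].
  exists (Rmin d1 d2). split; [apply Rmin_glb_lt; auto|]. intros s Hs Hst.
  specialize (H1 s Hs ltac:(pose proof (Rmin_l d1 d2); lra)).
  specialize (H2 s Hs ltac:(pose proof (Rmin_r d1 d2); lra)).
  replace (f s + g s - (f t + g t)) with ((f s - f t) + (g s - g t)) by ring.
  eapply Rle_lt_trans; [apply Rabs_triang|]. lra.
Qed.

Lemma cont_on_affine a b al be t0 : cont_on a b (fun s => al + be * (s - t0)).
Proof.
  intros t Ht eps He. pose proof (Rabs_pos be).
  exists (eps / (Rabs be + 1)). split; [apply Rdiv_lt_0_compat; lra|].
  intros s Hs Hst. replace (al + be * (s - t0) - (al + be * (t - t0))) with (be * (s - t)) by ring.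
  rewrite Rabs_mult. pose proof (Rabs_pos (s - t)).
  assert (Rabs (s - t) * (Rabs be + 1) < eps).
  { apply (Rmult_lt_compat_r (Rabs be + 1)) in Hst; [|lra]. unfold Rdiv in Hst.
    rewrite Rmult_assoc, Rinv_l, Rmult_1_r in Hst by lra. lra. }
  nra.
Qed.

Lemma cont_on_shift_scale (xi : R -> R) T t0 M : 0 <= M -> cont_on 0 T xi ->
  cont_on t0 (t0 + T) (fun s => xi (s - t0) * M).
Proof.
  intros HM Hc t Ht eps He.
  destruct (Hc (t - t0) ltac:(lra) (eps / (M + 1)) ltac:(apply Rdiv_lt_0_compat; lra))
    as [del [Hdel H]].
  exists del. split; [lra|]. intros s Hs Hst.
  specialize (H (s - t0) ltac:(lra) ltac:(replace (s - t0 - (t - t0)) with (s - t) by ring; auto)).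
  replace (xi (s - t0) * M - xi (t - t0) * M) with ((xi (s - t0) - xi (t - t0)) * M) by ring.
  rewrite Rabs_mult, (Rabs_right M) by lra.
  assert (eps / (M + 1) * M < eps).
  { replace (eps / (M + 1) * M) with (eps - eps / (M + 1)) by (field; lra).
    assert (0 < eps / (M + 1)) by (apply Rdiv_lt_0_compat; lra). lra. }
  pose proof (Rabs_pos (xi (s - t0) - xi (t - t0))). nra.
Qed.

Lemma le_of_le_plus_eps_mul a b c : 0 <= c -> (forall eps, 0 < eps -> a <= b + eps * c) -> a <= b.
Proof.
  intros Hc H. apply le_epsilon. intros eps He.
  specialize (H (eps / (c + 1)) ltac:(apply Rdiv_lt_0_compat; lra)).
  assert (eps / (c + 1) * c <= eps).
  { replace (eps / (c + 1) * c) with (eps - eps / (c + 1)) by (field; lra).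
    assert (0 < eps / (c + 1)) by (apply Rdiv_lt_0_compat; lra). lra. }
  lra.
Qed.

Lemma drive_bound N (e : nat -> bool) (al V : nat -> R) v lo hi D i :
  0 <= lo <= hi -> 0 <= D -> (i < N)%nat ->
  (forall q, (q < N)%nat -> e q = true -> lo <= al q <= hi) ->
  (forall q, (q < N)%nat -> V q - v <= D) ->
  rsum N (fun q => if e q then al q * (V q - v) else 0) <= INR N * (hi * D) /\
  (e i = true -> V i - v <= 0 ->
   rsum N (fun q => if e q then al q * (V q - v) else 0) <= lo * (V i - v) + INR N * (hi * D)).
Proof.
  intros Hlohi HD Hi Hal HV.
  assert (Hterm : forall q, (q < N)%nat -> (if e q then al q * (V q - v) else 0) <= hi * D).
  { intros q Hq. destruct (e q) eqn:Eq; [|apply Rmult_le_pos; nra].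
    destruct (Hal q Hq Eq). specialize (HV q Hq).
    destruct (Rle_dec (V q - v) 0); [nra|].
    apply Rle_trans with (hi * (V q - v)); [apply Rmult_le_compat_r; lra|].
    apply Rmult_le_compat_l; lra. }
  split.
  - rewrite <- rsum_const. apply rsum_le. auto.
  - intros Hei HVi. eapply Rle_trans;
      [apply (rsum_one_plus N _ i (hi * D)); [auto|apply Rmult_le_pos; lra|exact Hterm]|].
    cbv beta. rewrite Hei. destruct (Hal i Hi Hei). apply Rplus_le_compat_r.
    nra.
Qed.

Definition comparison_bound (xi : R -> R) (t0 M d0 rho0 r : R) : R :=
  xi (r - t0) * M + (d0 + rho0 * (r - t0)).

Lemma comparison_bound_rate_left c K tau t0 M d0 rho0 r : t0 <= r < t0 + tau ->
  lower_rate (comparison_bound (xi_fun c K tau) t0 M d0 rho0) r (rho0 - c * M).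
Proof.
  intros Hr. exists (t0 + tau - r). split; [lra|]. intros h Hh.
  unfold comparison_bound. rewrite !xi_fun_left by lra. right. ring.
Qed.

Lemma comparison_bound_rate_right c K tau t0 M d0 rho0 r eps :
  0 < c -> 0 < K -> 0 <= tau -> c * tau <= 1 -> 0 <= M -> 0 < eps -> t0 + tau <= r ->
  lower_rate (comparison_bound (xi_fun c K tau) t0 M d0 rho0) r
    (K * (1 - xi_fun c K tau (r - t0)) * M + rho0 - eps).
Proof.
  intros Hc HK Htau Hct HM He Hr.
  set (eta := eps / (M + 1)).
  assert (Heta : 0 < eta) by (unfold eta; apply Rdiv_lt_0_compat; lra).
  assert (HetaM : eta * M <= eps).
  { unfold eta. replace (eps / (M + 1) * M) with (eps - eps / (M + 1)) by (field; lra).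
    assert (0 < eps / (M + 1)) by (apply Rdiv_lt_0_compat; lra). lra. }
  exists (eta / (K * K)). split; [apply Rdiv_lt_0_compat; nra|]. intros h Hh.
  pose proof (xi_fun_tail_growth c K tau (r - t0) h eta Hc HK Hct Htau ltac:(lra)
                ltac:(lra) Heta ltac:(lra)) as Hg.
  unfold comparison_bound. replace (r + h - t0) with (r - t0 + h) by ring.
  set (xr := xi_fun c K tau (r - t0)) in *.
  assert (Hstep : h * (K * (1 - xr) - eta) * M <= (xi_fun c K tau (r - t0 + h) - xr) * M)
    by (apply Rmult_le_compat_r; lra).
  assert (h * (eta * M) <= h * eps) by (apply Rmult_le_compat_l; lra).
  nra.
Qed.

Lemma affine_lower_rate al be t0 r : lower_rate (fun s => al + be * (s - t0)) r be.
Proof. exists 1. split; [lra|]. intros h _. right. ring. Qed.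

Definition xi_mu0 (n : nat) (a_lo a_hi tau mu0 : R) : R -> R :=
  xi_fun (contraction_rate a_lo (INR n * a_hi) tau mu0) (INR n * a_hi) tau.

Section Trajectory.

Variables (n k d : nat) (a_lo a_hi Z : R) (sg : R -> digraph)
  (a b : nat -> nat -> (nat -> nat -> R) -> (nat -> nat -> R) -> R -> R)
  (u : nat -> (nat -> nat -> R) -> R -> nat -> R)
  (w : nat -> R -> nat -> R) (x y : R -> nat -> nat -> R).

Hypothesis Hk : (1 <= k)%nat.
Hypothesis Ha_lo : 0 < a_lo.
Hypothesis Ha : forall l q, (l < n)%nat -> (q < n)%nat ->
  forall X Y t, 0 <= t -> a_lo <= a l q X Y t <= a_hi.
Hypothesis Hb : forall l j, (l < n)%nat -> (j < k)%nat ->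
  forall X Y t, 0 <= t -> 0 <= b l j X Y t.
Hypothesis Htraj : trajectory n k d sg a b u w x y.
Hypothesis HZ : forall s, 0 <= s -> z_norm n k d u w y s <= Z.

Definition V (l : nat) (s : R) : R := hull_dist d k (x s l) (y s).

Lemma V_cont l a0 b0 : (l < n)%nat -> 0 <= a0 -> cont_on a0 b0 (V l).
Proof.
  intros Hl Ha0. destruct Htraj as [Hxc [Hyc _]].
  apply hull_dist_cont; auto.
Qed.

Lemma V_upper_rate T : exists E : list R, forall r, 0 < r <= T -> ~ In r E ->
  forall l, (l < n)%nat -> upper_rate (V l) r (hull_drive n d k sg a x y l r + 2 * Z).
Proof.
  destruct Htraj as [_ [_ [D0 [HDfin HDder]]]].
  destruct (HDfin T) as [E HE]. exists E. intros r Hr HrE l Hl.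
  destruct (HDder r ltac:(lra)) as [Hdy Hdx]; [intros HD; apply HrE, HE; auto; lra|].
  destruct (z_norm_bounds n k d u w y r) as [Hw Hu].
  apply (hull_dist_rate n k d sg a b u w x y Z l r); auto.
  - intros q Hq. destruct (Ha l q Hl Hq (x r) (y r) r ltac:(lra)). lra.
  - intros j Hj. apply Hb; auto; lra.
  - eapply Rle_trans; [apply Hw; auto|apply HZ; lra].
  - intros j Hj. eapply Rle_trans; [apply Hu; auto|apply HZ; lra].
Qed.

Lemma V_drive_bound l i r D : (l < n)%nat -> (i < n)%nat -> 0 <= r -> 0 <= D ->
  (forall q, (q < n)%nat -> V q r - V l r <= D) ->
  hull_drive n d k sg a x y l r <= INR n * a_hi * D /\
  (sg r (Fol i) (Fol l) = true -> V i r - V l r <= 0 ->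
   hull_drive n d k sg a x y l r <= a_lo * (V i r - V l r) + INR n * a_hi * D).
Proof.
  intros Hl Hi Hr HD Hgap.
  assert (Hlohi : 0 <= a_lo <= a_hi) by (destruct (Ha l l Hl Hl (x r) (y r) r Hr); lra).
  destruct (drive_bound n (fun q => sg r (Fol q) (Fol l)) (fun q => a l q (x r) (y r) r)
              (fun q => V q r) (V l r) a_lo a_hi D i Hlohi HD Hi) as [H1 H2]; auto.
  rewrite Rmult_assoc. split; [exact H1|exact H2].
Qed.

Lemma V_init_le l t0 : (l < n)%nat -> V l t0 <= max_hull_dist n d k (x t0) (y t0).
Proof. intros Hl. apply max_hull_ge; auto. Qed.

(** Growth bound: no V_q exceeds its initial maximum by more than 2 Z (s - t0),
    since a maximal V_q has a nonpositive drive. *)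
Lemma V_growth t0 T : 0 <= t0 -> forall s, t0 <= s <= t0 + T -> forall l, (l < n)%nat ->
  V l s <= max_hull_dist n d k (x t0) (y t0) + 2 * Z * (s - t0).
Proof.
  intros Ht0 s Hs l Hl. set (M := max_hull_dist n d k (x t0) (y t0)).
  apply (le_of_le_plus_eps_mul _ _ (s - t0)); [lra|]. intros eps Heps.
  destruct (V_upper_rate (t0 + T)) as [E HE].
  set (g := fun r => M + (2 * Z + eps) * (r - t0)).
  enough (V l s - g s <= 0) by (unfold g in *; lra).
  apply (max_principle n (fun q r => V q r - g r) E t0 (t0 + T)); auto.
  - intros q Hq. apply cont_on_minus; [apply V_cont; auto|apply cont_on_affine].
  - intros q Hq. unfold g. replace (t0 - t0) with 0 by ring.
    pose proof (V_init_le q t0 Hq) as Hq0. fold M in Hq0. lra.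
  - intros r Hr HrE q Hq _ Hmax.
    assert (Hdrive : hull_drive n d k sg a x y q r <= 0).
    { destruct (V_drive_bound q q r 0 Hq Hq ltac:(lra) ltac:(lra)) as [Hd _].
      - intros q' Hq'. specialize (Hmax q' Hq'). lra.
      - lra. }
    apply (right_nonincr_of_rates _ _ _ (2 * Z) (2 * Z + eps)); [lra| |apply affine_lower_rate].
    apply (upper_rate_mono _ _ (hull_drive n d k sg a x y q r + 2 * Z)); [lra|].
    apply HE; auto; lra.
Qed.

Lemma V_drive_contraction c K mu0 i m r M xr : K = INR n * a_hi ->
  (i < n)%nat -> (m < n)%nat -> 0 <= r -> 0 <= M -> mu0 <= xr <= 1 ->
  a_lo * mu0 + K + c <= (a_lo + K) * xr -> sg r (Fol i) (Fol m) = true ->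
  V i r - V m r <= (mu0 - xr) * M ->
  (forall q, (q < n)%nat -> V q r - V m r <= (1 - xr) * M) ->
  hull_drive n d k sg a x y m r <= - c * M.
Proof.
  intros HK Hi Hm Hr HM Hxr Hslope Harc Hpull Hgap.
  destruct (V_drive_bound m i r ((1 - xr) * M) Hm Hi Hr ltac:(nra) Hgap) as [_ Harc_bound].
  eapply Rle_trans; [apply Harc_bound; [auto|nra]|]. rewrite <- HK.
  assert (a_lo * (V i r - V m r) <= a_lo * ((mu0 - xr) * M)) by (apply Rmult_le_compat_l; lra).
  assert ((a_lo * mu0 + K - (a_lo + K) * xr) * M <= (- c) * M) by (apply Rmult_le_compat_r; lra).
  nra.
Qed.

Lemma V_comparison_step c K tau mu0 M t0 d0 eps i m r : K = INR n * a_hi ->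
  0 < c -> 0 < K -> 0 < tau -> c * tau < 1 - mu0 -> 0 < mu0 ->
  (forall s, 0 <= s <= tau -> a_lo * mu0 + K + c <= (a_lo + K) * (1 - c * s)) ->
  0 <= M -> 0 <= Z -> 0 < d0 -> 0 < eps -> (i < n)%nat -> (m < n)%nat ->
  0 <= t0 -> t0 < r ->
  (r - t0 < tau -> sg r (Fol i) (Fol m) = true /\ V i r <= mu0 * M + d0) ->
  (forall q, (q < n)%nat -> V q r <= M + 2 * Z * (r - t0)) ->
  upper_rate (V m) r (hull_drive n d k sg a x y m r + 2 * Z) ->
  0 <= V m r - comparison_bound (xi_fun c K tau) t0 M d0 (2 * Z + eps) r ->
  right_nonincr (fun s => V m s - comparison_bound (xi_fun c K tau) t0 M d0 (2 * Z + eps) s) r.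
Proof.
  intros HK Hc HKp Htau Hct Hmu Hslope HM HZ0 Hd0 Heps Hi Hm Ht0 Hr Hphase1 Hgrowth Hrate Hpos.
  unfold comparison_bound in Hpos.
  set (xr := xi_fun c K tau (r - t0)) in *.
  assert (Hxr : xr <= 1) by (apply xi_fun_le_1; lra).
  assert (Hslack : 0 <= (2 * Z + eps) * (r - t0)) by nra.
  assert (Hgap : forall q, (q < n)%nat -> V q r - V m r <= (1 - xr) * M)
    by (intros q Hq; pose proof (Hgrowth q Hq); nra).
  destruct (Rlt_le_dec (r - t0) tau) as [Hlt|Hge].
  - destruct (Hphase1 Hlt) as [Harc Hpull].
    assert (Hxr_eq : xr = 1 - c * (r - t0)) by (apply xi_fun_left; lra).
    assert (Hmu_xr : mu0 <= xr) by (assert (c * (r - t0) <= c * tau) by nra; lra).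
    pose proof (Hslope (r - t0) ltac:(lra)) as Hsl. rewrite <- Hxr_eq in Hsl.
    assert (Hneg : hull_drive n d k sg a x y m r <= - c * M).
    { apply (V_drive_contraction c K mu0 i m r M xr); auto; lra. }
    apply (right_nonincr_of_rates _ _ _ (- c * M + 2 * Z) (2 * Z + eps - c * M)); [lra| |].
    + apply (upper_rate_mono _ _ (hull_drive n d k sg a x y m r + 2 * Z)); auto; lra.
    + apply comparison_bound_rate_left; lra.
  - destruct (V_drive_bound m m r ((1 - xr) * M) Hm Hm ltac:(lra) ltac:(nra) Hgap)
      as [Hdrive _].
    apply (right_nonincr_of_rates _ _ _ (K * (1 - xr) * M + 2 * Z)
                                      (K * (1 - xr) * M + (2 * Z + eps) - eps / 2)); [lra| |].
    + apply (upper_rate_mono _ _ (hull_drive n d k sg a x y m r + 2 * Z)); [|auto].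
      rewrite HK. lra.
    + apply comparison_bound_rate_right; auto; lra.
Qed.

(** The comparison estimate of Lemma 6, by the maximum principle applied to
    [V_m] minus the comparison bound. *)
Lemma V_comparison tau Tstar mu0 t0 d0 i m :
  0 < tau -> tau < Tstar -> 0 < mu0 < 1 -> 0 <= t0 -> 0 < d0 -> (i < n)%nat -> (m < n)%nat ->
  (forall t, t0 <= t < t0 + tau -> sg t (Fol i) (Fol m) = true) ->
  (forall t, t0 <= t < t0 + tau -> V i t <= mu0 * max_hull_dist n d k (x t0) (y t0) + d0) ->
  forall t, t0 <= t <= t0 + Tstar ->
    V m t <= xi_mu0 n a_lo a_hi tau mu0 (t - t0) * max_hull_dist n d k (x t0) (y t0)
             + 2 * Z * (t - t0) + d0.
Proof.
  intros Htau HT Hmu Ht0 Hd0 Hi Hm Harc Hpull t Ht. unfold xi_mu0.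
  set (M := max_hull_dist n d k (x t0) (y t0)) in *.
  assert (HM : 0 <= M) by apply max_hull_nonneg.
  assert (HZ0 : 0 <= Z) by (eapply Rle_trans; [apply sqrt_pos|apply (HZ t0 Ht0)]).
  set (K := INR n * a_hi).
  assert (HK : 0 < K).
  { destruct (Ha i i Hi Hi (x t0) (y t0) t0 Ht0).
    assert (1 <= INR n) by (replace 1 with (INR 1) by reflexivity; apply le_INR; lia).
    unfold K; nra. }
  destruct (contraction_rate_spec a_lo K tau mu0 Ha_lo HK Htau Hmu) as [Hc [Hct Hslope]].
  set (c := contraction_rate a_lo K tau mu0) in *.
  apply (le_of_le_plus_eps_mul _ _ (t - t0)); [lra|]. intros eps Heps.
  destruct (V_upper_rate (t0 + Tstar)) as [E HE].
  set (g := comparison_bound (xi_fun c K tau) t0 M d0 (2 * Z + eps)).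
  enough (V m t - g t <= 0) by (unfold g, comparison_bound in *; lra).
  refine (max_principle 1 (fun _ r => V m r - g r) E t0 (t0 + Tstar)
            _ _ _ t Ht 0%nat ltac:(lia)).
  - intros q _. apply cont_on_minus; [apply V_cont; auto|].
    apply cont_on_plus; [apply cont_on_shift_scale; [exact HM|apply xi_fun_cont; auto]|].
    apply cont_on_affine.
  - intros q _. unfold g, comparison_bound. replace (t0 - t0) with 0 by ring.
    rewrite xi_fun_left by lra. pose proof (V_init_le m t0 Hm) as Hm0. fold M in Hm0. lra.
  - intros r Hr HrE q _ Hpos _.
    apply (V_comparison_step c K tau mu0 M t0 d0 eps i m r); auto; try lra.
    + intros Hlt. split; [apply Harc; lra|apply Hpull; lra].
    + intros q' Hq'. apply (V_growth t0 Tstar); auto; lra.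
    + apply HE; auto; lra.
Qed.

End Trajectory.

Theorem lemma6 (n : nat) (a_lo a_hi tauD Tstar mu0 : R) :
  (2 <= n)%nat -> 0 < a_lo -> a_lo <= a_hi -> 0 < tauD -> Tstar > tauD ->
  0 < mu0 < 1 ->
  exists (xi : R -> R) (gamma2 : R),
    cont_on 0 Tstar xi /\
    (forall s, 0 <= s <= Tstar -> 0 < xi s <= 1) /\
    xi 0 = 1 /\
    (forall s1 s2, 0 <= s1 -> s1 < s2 -> s2 <= tauD -> xi s2 < xi s1) /\
    (forall s1 s2, tauD <= s1 -> s1 < s2 -> s2 <= Tstar -> xi s1 < xi s2) /\
    xi Tstar < 1 /\
    gamma2 > 0 /\
    forall (k d : nat) (b_lo : R) (sg : R -> digraph)
      (a b : nat -> nat -> (nat -> nat -> R) -> (nat -> nat -> R) -> R -> R)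
      (u : nat -> (nat -> nat -> R) -> R -> nat -> R)
      (w : nat -> R -> nat -> R)
      (x y : R -> nat -> nat -> R) (Z : R),
      (1 <= k)%nat -> (1 <= d)%nat -> 0 < b_lo ->
      dwell_signal tauD sg ->
      system_data n k d a_lo a_hi b_lo a b u w ->
      trajectory n k d sg a b u w x y ->
      is_lub (fun r => exists t, 0 <= t /\ r = z_norm n k d u w y t) Z ->
      forall (t0 d0 : R) (i m : nat),
        0 <= t0 -> 0 < d0 -> (i < n)%nat -> (m < n)%nat ->
        (forall t, t0 <= t < t0 + tauD -> sg t (Fol i) (Fol m) = true) ->
        (forall t, t0 <= t < t0 + tauD ->
           hull_dist d k (x t i) (y t)
             <= mu0 * max_hull_dist n d k (x t0) (y t0) + d0) ->
        forall t, t0 <= t <= t0 + Tstar ->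
          hull_dist d k (x t m) (y t)
            <= xi (t - t0) * max_hull_dist n d k (x t0) (y t0) + gamma2 * Z + d0.
Proof.
  intros Hn Halo Hahi Htau HT Hmu.
  set (K := INR n * a_hi).
  assert (HK : 0 < K).
  { assert (1 <= INR n) by (replace 1 with (INR 1) by reflexivity; apply le_INR; lia).
    unfold K; nra. }
  destruct (contraction_rate_spec a_lo K tauD mu0 Halo HK Htau Hmu) as [Hc [Hct _]].
  exists (xi_mu0 n a_lo a_hi tauD mu0), (2 * Tstar).
  destruct (xi_fun_shape _ K tauD Tstar Hc HK Htau HT ltac:(lra))
    as [Hcont [Hrange [H0 [Hdec [Hinc Hend]]]]].
  refine (conj Hcont (conj Hrange (conj H0 (conj Hdec (conj Hinc (conj Hend (conj _ _)))))));
    [lra|].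
  intros k d b_lo sg a b u w x y Z Hk _ Hblo _ [Hadata [Hbdata _]] Htraj HZ
         t0 d0 i m Ht0 Hd0 Hi Hm Harc Hpull t Ht.
  assert (HZs : forall s, 0 <= s -> z_norm n k d u w y s <= Z)
    by (intros s Hs; apply (proj1 HZ); exists s; auto).
  assert (HZ0 : 0 <= Z) by (eapply Rle_trans; [apply sqrt_pos|apply (HZs 0); lra]).
  assert (Hb : forall l j, (l < n)%nat -> (j < k)%nat ->
                forall X Y s, 0 <= s -> 0 <= b l j X Y s).
  { intros l j Hl Hj X Y s Hs. pose proof (proj2 (Hbdata l j Hl Hj) X Y s Hs). lra. }
  pose proof (V_comparison n k d a_lo a_hi Z sg a b u w x y Hk Halo
    (fun l q Hl Hq => proj2 (Hadata l q Hl Hq)) Hb Htraj HZs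
    tauD Tstar mu0 t0 d0 i m Htau HT Hmu Ht0 Hd0 Hi Hm Harc Hpull t Ht) as Hcomp.
  unfold V in Hcomp.
  assert (Z * (t - t0) <= Z * Tstar) by (apply Rmult_le_compat_l; lra).
  lra.
Qed.
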